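(* Let $p$ and $q$ be prime numbers, let $G$ be a $(p,q)$-Dress group that is not $p$-hypo-elementary, and let $a$ be an integer. Then there exists an element in $K_{\mathbb{F}_p}(G)$ of the form $a[G/G]+\sum_{H\lneq G}a_H[G/H]$ with $a_H\in \mathbb{Z}$ if and only if $q\mid a$.
   Context: All groups are finite. The Burnside ring $B(G)$ is, as a group, the free abelian group on isomorphism classes $[G/H]$ of transitive $G$-sets; the class of a finite $G$-set is the sum of the classes of its orbits. $R_{\mathbb{F}_p}(G)$ is the free abelian group on isomorphism classes of finitely generated indecomposable $\mathbb{F}_p[G]$-modules (equivalently, the free abelian group on isomorphism classes $[V]$ of finitely generated $\mathbb{F}_p[G]$-modules modulo the relations $[U\oplus V]=[U]+[V]$; this is not the Grothendieck group with respect to short exact sequences). $K_{\mathbb{F}_p}(G)$ is the kernel of the homomorphism $B(G)\to R_{\mathbb{F}_p}(G)$ sending the class of a $G$-set $X$ to the class of the permutation module $\mathbb{F}_p[X]$. For prime numbers $p,q$ (possibly equal): a finite group is $q$-quasi-elementary if it has a normal cyclic subgroup of $q$-power index; it is $p$-hypo-elementary if it has a normal $p$-subgroup with cyclic quotient; it is a $(p,q)$-Dress group if it has a normal $p$-subgroup with $q$-quasi-elementary quotient. (Trivial groups are allowed as $p$-groups, and index $1$ counts as a $q$-power index.) *)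

(* Defs.v *)
From HB Require Import structures.
From mathcomp Require Import all_boot all_fingroup all_order all_algebra.
From mathcomp Require Import all_solvable mxrepresentation character.
From mathcomp Require Import ring_quotient generic_quotient.
From mathcomp.classical Require Import boolp.
From mathcomp Require Import freeg.

Set Implicit Arguments.
Unset Strict Implicit.
Unset Printing Implicit Defensive.

Import GRing.Theory.
Local Open Scope group_scope.
Local Open Scope ring_scope.
Local Open Scope quotient_scope.

Section GroupClasses.

Definition quasi_elementary (q : nat) (gT : finGroupType) (G : {set gT}) :=
  [exists C : {group gT}, [&& C <| G, cyclic C & q.-nat #|G : C|%g]].

Definition hypo_elementary (p : nat) (gT : finGroupType) (G : {set gT}) :=
  [exists P : {group gT}, [&& P <| G, p.-group P & cyclic (G / P)%g]].

Definition dress (p q : nat) (gT : finGroupType) (G : {set gT}) :=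
  [exists P : {group gT},
     [&& P <| G, p.-group P & quasi_elementary q (G / P)%g]].

End GroupClasses.

(* R_F(G), presented as the free abelian group on all finite-dimensional      *)
(* F[G]-modules modulo isomorphisms and the relations [U (+) V] = [U] + [V]   *)
(* for (split) direct sums only.                                              *)

Section RepresentationGroup.

Variables (F : fieldType) (gT : finGroupType) (G : {group gT}).
Implicit Types U V : representation F G.

Definition free_repr := {freeg {classic representation F G} / int}.
HB.instance Definition _ := GRing.Lmodule.on free_repr.

Definition repr_gen U : free_repr := << 1 *g (U : {classic representation F G}) >>.

Inductive dsum_null : free_repr -> Prop :=
| dsum_null_iso U V of mx_rsim U V : dsum_null (repr_gen U - repr_gen V)
| dsum_null_add U V :
    dsum_null (repr_gen (dadd_grepr U V) - (repr_gen U + repr_gen V))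
| dsum_null0 : dsum_null 0
| dsum_nullB x y of dsum_null x & dsum_null y : dsum_null (x - y).

Definition dsum_null_pred : {pred free_repr} := [pred x | `[< dsum_null x >]].

Lemma dsum_null_zmod_closed : zmod_closed dsum_null_pred.
Proof.
split=> [|x y]; rewrite !inE; first by apply/asboolP/dsum_null0.
by move=> /asboolP nx /asboolP ny; apply/asboolP/dsum_nullB.
Qed.
HB.instance Definition _ :=
  GRing.isZmodClosed.Build free_repr dsum_null_pred dsum_null_zmod_closed.

Definition repr_group := Quotient.quot dsum_null_pred.
HB.instance Definition _ := GRing.Zmodule.on repr_group.

Definition repr_class U : repr_group :=
  \pi_(Quotient.quot dsum_null_pred) (repr_gen U).

Lemma repr_class_iso U V : mx_rsim U V -> repr_class U = repr_class V.
Proof.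
move=> isoUV; apply/eqP; rewrite -[_ == _]Quotient.idealrBE inE.
by apply/asboolP/dsum_null_iso.
Qed.

Lemma repr_class_add U V :
  repr_class (dadd_grepr U V) = repr_class U + repr_class V.
Proof.
rewrite /repr_class -[RHS]raddfD; apply/eqP.
by rewrite -[_ == _]Quotient.idealrBE inE; apply/asboolP/dsum_null_add.
Qed.

End RepresentationGroup.

(* Groups act on the right, as everywhere in MathComp: mx_representation is   *)
(* also a right module of row vectors.  Composing with inversion exchanges    *)
(* left and right G-sets and modules, and G/H becomes the set of right cosets.*)

Section GSets.

Variables (gT : finGroupType) (G : {group gT}).

Record gset := GSet { gcarrier :> finType; gact : action G gcarrier }.

Implicit Types X Y Z : gset.

Definition gset_iso X Y : Prop :=
  exists2 f : X -> Y, bijective f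
    & forall x, {in G, forall g, f (gact X x g) = gact Y (f x) g}.

Lemma gset_iso_refl X : gset_iso X X.
Proof. by exists id => //; exists id. Qed.

Lemma gset_iso_sym X Y : gset_iso X Y -> gset_iso Y X.
Proof.
case=> f [f' fK f'K] eqf; exists f'; first by exists f.
by move=> y g Gg; apply: (can_inj fK); rewrite eqf // !f'K.
Qed.

Lemma gset_iso_trans X Y Z : gset_iso X Y -> gset_iso Y Z -> gset_iso X Z.
Proof.
case=> f bf eqf [h bh eqh]; exists (h \o f); first exact: bij_comp.
by move=> x g Gg; rewrite /= eqf // eqh.
Qed.


Lemma gset_iso_inj X Y (f : X -> Y) :
  injective f -> #|X| = #|Y| ->
  (forall x, {in G, forall g, f (gact X x g) = gact Y (f x) g}) ->
  gset_iso X Y.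
Proof. by move=> injf cXY eqf; exists f => //; apply: inj_card_bij; rewrite ?cXY. Qed.

Section SubGSet.

Variables (D : {group gT}) (T : finType) (to : action D T) (S : {set T}).
Hypothesis nSG : [acts G, on S | to].

Lemma gsub_dom : G \subset subact_dom (fun x => x \in S) to.
Proof.
apply: subset_trans nSG _; rewrite /subact_dom.
by have ->: [set x | x \in S] = S by apply/setP=> x; rewrite inE.
Qed.

Definition gsub := GSet ((to^? : action _ {x | x \in S}) \ gsub_dom)%act.

Lemma val_gsub (x : gsub) g :
  g \in G -> val (gact gsub x g) = to (val x) g.
Proof. by move=> Gg; rewrite /= val_subact (subsetP gsub_dom). Qed.

Lemma card_gsub : #|gsub| = #|S|.
Proof. exact: card_sig. Qed.

End SubGSet.

Section SumGSet.

Variables X Y : gset.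

Definition gsum_act (z : X + Y) g : X + Y :=
  match z with inl x => inl (gact X x g) | inr y => inr (gact Y y g) end.

Lemma gsum_is_action : is_action G gsum_act.
Proof.
split=> [g [x|y] [x'|y'] //= [] /act_inj-> // | [x|y] g h Gg Gh /=].
  by rewrite actMin.
by rewrite actMin.
Qed.

Definition gsum := GSet (Action gsum_is_action).

End SumGSet.

Lemma gsub_disjoint (D : {group gT}) (T : finType) (to : action D T)
    (S S1 S2 : {set T}) (nS : [acts G, on S | to])
    (nS1 : [acts G, on S1 | to]) (nS2 : [acts G, on S2 | to]) :
  S1 :|: S2 = S -> [disjoint S1 & S2] ->
  gset_iso (gsum (gsub nS1) (gsub nS2)) (gsub nS).
Proof.
move=> defS dS12.
have in1 (x : {x | x \in S1}) : val x \in S by rewrite -defS inE (valP x).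
have in2 (x : {x | x \in S2}) : val x \in S by rewrite -defS inE (valP x) orbT.
pose f (z : gsum (gsub nS1) (gsub nS2)) : gsub nS :=
  match z with
  | inl x => exist (fun x => x \in S) _ (in1 x)
  | inr x => exist (fun x => x \in S) _ (in2 x)
  end.
have ne12 (x : {x | x \in S1}) (y : {x | x \in S2}) : val x != val y.
  apply: contraTneq (valP x) => ->.
  by rewrite (disjointFl dS12 (valP y)).
apply: (@gset_iso_inj _ _ f).
- move=> [x|x] [y|y] /(congr1 val) /= eqxy.
  + by congr inl; apply: val_inj.
  + by case/eqP: (ne12 x y).
  + by case/eqP: (ne12 y x).
  + by congr inr; apply: val_inj.
- rewrite card_sum !card_gsub -defS cardsU disjoint_setI0 // cards0 subn0 //.
by case=> x g Gg; apply: val_inj;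
  rewrite [RHS](val_gsub (f _) Gg) [LHS](val_gsub x Gg).
Qed.

Lemma gsubT X (nX : [acts G, on [set: X] | gact X]) : gset_iso (gsub nX) X.
Proof.
apply: (@gset_iso_inj _ _ (fun x : gsub nX => val x)); first exact: val_inj.
  by rewrite card_gsub cardsT.
by move=> x g Gg; rewrite (val_gsub x Gg).
Qed.

Definition cosets (H : {group gT}) : gset := gsub (actsRs_rcosets H G).

Lemma orbit_cosets X (x : X) :
  gset_iso (gsub (acts_orbit (gact X) x (subxx G))) (cosets 'C_G[x | gact X]).
Proof.
have injA := can_in_inj (amoveK (to := gact X) (x := x) (subxx G)).
have defA := amove_orbit (gact X) x (subxx G).
have amoveP (y : {y | y \in orbit (gact X) G x}) :
    amove (gact X) G x (val y) \in rcosets 'C_G[x | gact X] G.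
  by rewrite -defA imset_f ?(valP y).
pose f y : cosets 'C_G[x | gact X] :=
  exist (fun A => A \in rcosets 'C_G[x | gact X] G) _ (amoveP y).
apply: (@gset_iso_inj (gsub _) _ f).
- move=> y z /(congr1 val) /= eq_yz; apply: val_inj => /=.
  by apply: injA eq_yz; apply: valP.
- by rewrite !card_gsub -defA (card_in_imset injA).
move=> y g Gg; apply: val_inj.
rewrite [LHS](congr1 (amove (gact X) G x) (val_gsub y Gg)).
rewrite [RHS](val_gsub (f y) Gg) /=.
have /orbitP[a Ga <-] := valP y.
by rewrite -actMin // !amove_act ?groupM // rcosetM -rcosetE.
Qed.

End GSets.

Section PermutationModule.

Variables (F : fieldType) (gT : finGroupType) (G : {group gT}).
Implicit Types X Y : gset G.

Lemma sum_indicator (I : finType) (T : eqType) (b : I -> T) (b' : T -> I) :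
  cancel b b' -> cancel b' b ->
  forall x (E : I -> F), \sum_i (x == b i)%:R * E i = E (b' x).
Proof.
move=> bK b'K x E; rewrite (bigD1 (b' x)) //= b'K eqxx mul1r.
rewrite big1 ?addr0 // => i; case: (x =P b i) => [-> | _ _]; last by rewrite mul0r.
by rewrite bK eqxx.
Qed.

(* The standard basis vector of x is sent to that of gact X x g.              *)
Definition perm_mod_mx X (g : gT) : 'M[F]_#|X| :=
  \matrix_(i, j) (gact X (enum_val i) g == enum_val j)%:R.

Lemma perm_mod_mx_repr X : mx_repr G (perm_mod_mx X).
Proof.
split=> [|g h Gg Gh]; apply/matrixP=> i j; rewrite !mxE.
  by rewrite act1 (inj_eq enum_val_inj).
under eq_bigr do rewrite !mxE.
by rewrite (sum_indicator enum_valK enum_rankK) enum_rankK actMin.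
Qed.

Definition perm_mod X : representation F G :=
  Representation (MxRepresentation (perm_mod_mx_repr X)).

Lemma perm_mod_rsim X (n : nat) (rG : mx_representation F G n) (b : 'I_n -> X) :
  bijective b ->
  {in G, forall g i j, rG g i j = (gact X (b i) g == b j)%:R} ->
  mx_rsim (perm_mod X) rG.
Proof.
case=> b' bK b'K eq_rG.
have cXn: #|X| = n.
  by rewrite -[RHS]card_ord; apply: (@bij_eq_card _ _ b'); exists b.
exists (\matrix_(i, j) (enum_val i == b j)%:R) => //.
  apply/row_freeP.
  exists (\matrix_(i, j) (b i == enum_val j)%:R); apply/matrixP=> i j.
  rewrite !mxE; under eq_bigr do rewrite !mxE.
  by rewrite (sum_indicator bK b'K) b'K (inj_eq enum_val_inj).
move=> g Gg; apply/matrixP=> i j; rewrite !mxE.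
under eq_bigr do rewrite !mxE; rewrite (sum_indicator enum_valK enum_rankK).
under [RHS]eq_bigr do rewrite !mxE; rewrite (sum_indicator bK b'K).
by rewrite eq_rG // b'K enum_rankK.
Qed.

Lemma perm_mod_iso X Y : gset_iso X Y -> mx_rsim (perm_mod X) (perm_mod Y).
Proof.
case/gset_iso_sym=> f bf eqf; apply: (@perm_mod_rsim _ _ _ (f \o enum_val)).
  by apply: bij_comp => //; apply: enum_val_bij.
move=> g Gg i j /=; rewrite mxE -eqf // (inj_eq (bij_inj bf)) //.
Qed.

Lemma perm_mod_sum X Y :
  mx_rsim (perm_mod (gsum X Y)) (dadd_grepr (perm_mod X) (perm_mod Y)).
Proof.
pose b (i : 'I_(#|X| + #|Y|)) : gsum X Y :=
  match split i with inl j => inl (enum_val j) | inr j => inr (enum_val j) end.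
apply: (@perm_mod_rsim _ _ _ b).
  pose b' (z : gsum X Y) : 'I_(#|X| + #|Y|) := unsplit
    match z with inl x => inl (enum_rank x) | inr y => inr (enum_rank y) end.
  exists b' => [i | z]; rewrite /b /b' ?unsplitK; last first.
    by case: z => z; rewrite enum_rankK.
  by rewrite -[RHS]splitK; case: (split i) => j; rewrite enum_valK.
move=> g Gg i j; rewrite -[i]splitK -[j]splitK /b !unsplitK /=.
case: (split i) => i'; case: (split j) => j' /=.
- by rewrite block_mxEul mxE.
- by rewrite block_mxEur mxE.
- by rewrite block_mxEdl mxE.
- by rewrite block_mxEdr mxE.
Qed.

Lemma perm_mod_class_sum X Y :
  repr_class (perm_mod (gsum X Y)) =
    repr_class (perm_mod X) + repr_class (perm_mod Y).
Proof. by rewrite -repr_class_add; apply/repr_class_iso/perm_mod_sum. Qed.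

Lemma perm_mod_class_orbits X (s : seq X) (S : {set X})
    (nS : [acts G, on S | gact X]) :
  uniq s -> {in s &, forall x y, (y \in orbit (gact X) G x) = (x == y)} ->
  \bigcup_(x <- s) orbit (gact X) G x = S ->
  repr_class (perm_mod (gsub nS)) =
    \sum_(x <- s) repr_class (perm_mod (cosets G 'C_G[x | gact X])).
Proof.
elim: s S nS => [|x s IHs] S nS /=; rewrite ?(big_nil, big_cons).
  move=> _ _ def0; apply/(addrI (repr_class (perm_mod (gsub nS)))).
  rewrite addr0 -perm_mod_class_sum; apply/repr_class_iso/perm_mod_iso.
  by apply: gsub_disjoint; rewrite -?def0 ?setU0 // -setI_eq0 setI0.
case/andP=> s'x uniq_s ort defS.
have nS' : [acts G, on \bigcup_(y <- s) orbit (gact X) G y | gact X].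
  elim: (s) => [|y s' IH]; rewrite ?(big_nil, big_cons).
    by apply/subsetP=> g Gg; rewrite !inE Gg sub0set.
  by rewrite actsU // acts_orbit.
rewrite -(IHs _ nS' uniq_s) => [||//]; last first.
  by move=> y z sy sz; apply: ort; rewrite inE ?sy ?sz orbT.
rewrite -(repr_class_iso (perm_mod_iso (orbit_cosets x))) -perm_mod_class_sum.
apply/esym/repr_class_iso/perm_mod_iso/gsub_disjoint => //.
rewrite -setI_eq0; apply/eqP/setP=> z; rewrite !inE; apply/andP=> -[xz].
rewrite big_tnth => /bigcupP[i _ iz].
have sy := mem_tnth i (in_tuple s); set y := tnth _ _ in sy iz.
suff: x == y by move/eqP=> eq_xy; rewrite eq_xy sy in s'x.
rewrite -ort ?inE ?eqxx ?sy ?orbT //.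
by rewrite orbit_in_sym // in iz; apply: orbit_in_trans iz xz.
Qed.

End PermutationModule.

(* The transitive G-sets up to isomorphism are the G/H up to isomorphism, by  *)
(* orbit_cosets: B(G) is the free abelian group on these classes, and         *)
(* gset_class X is the class in B(G) of an arbitrary finite G-set X.          *)

Section BurnsideGroup.

Variables (gT : finGroupType) (G : {group gT}).

Definition subgroup_of := {H : {group gT} | H \subset G}.
Implicit Types H K : subgroup_of.

Definition whole_group : subgroup_of :=
  exist (fun H : {group gT} => H \subset G) G (subxx G).

Definition same_cosets : rel subgroup_of :=
  [rel H K | `[< gset_iso (cosets G (val H)) (cosets G (val K)) >]].

Lemma same_cosets_equiv : equiv_class_of same_cosets.
Proof.
split=> [H | H K | K H L] /=.
- exact/asboolP/gset_iso_refl.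
- by apply/asboolP/asboolP=> /gset_iso_sym.
- by move=> /asboolP HK /asboolP KL; apply/asboolP/(gset_iso_trans HK).
Qed.
Canonical same_cosets_equiv_rel := EquivRelPack same_cosets_equiv.

Definition transitive_class := {eq_quot same_cosets}.
HB.instance Definition _ := Choice.on transitive_class.

Definition burnside := {freeg transitive_class / int}.
HB.instance Definition _ := GRing.Lmodule.on burnside.

Definition coset_class H : burnside := << 1 *g \pi_transitive_class H >>.

Definition stabilizer (X : gset G) (x : X) : subgroup_of :=
  exist (fun H : {group gT} => H \subset G) 'C_G[x | gact X]%G (subsetIl _ _).

Definition gset_class (X : gset G) : burnside :=
  \sum_(x in orbit_transversal (gact X) G [set: X]) coset_class (stabilizer x).

Section PermutationMap.

Variable F : fieldType.

(* The lift of [G/H] |-> [F[G/H]]; it does not depend on repr, and sends      *)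
(* gset_class X to [F[X]], by burnside_repr_coset and burnside_repr_gset.     *)

Definition burnside_repr : burnside -> repr_group F G :=
  @fglift _ (zmodule (repr_group F G)) _
    (fun t : transitive_class =>
       repr_class (perm_mod F (cosets G (val (repr t))))).

Lemma burnside_repr_is_zmod_morphism : zmod_morphism burnside_repr.
Proof.
exact: (@lift_is_additive _ transitive_class (zmodule (repr_group F G))).
Qed.
HB.instance Definition _ :=
  GRing.isZmodMorphism.Build burnside (repr_group F G) burnside_repr
    burnside_repr_is_zmod_morphism.

Lemma burnside_repr_coset H :
  burnside_repr (coset_class H) = repr_class (perm_mod F (cosets G (val H))).
Proof.
rewrite /burnside_repr liftU scalezrE mulr1z.
apply/repr_class_iso/perm_mod_iso/asboolP.
by have /eqmodP := reprK (\pi_transitive_class H).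
Qed.

Lemma burnside_repr_gset (X : gset G) :
  burnside_repr (gset_class X) = repr_class (perm_mod F X).
Proof.
have nX : [acts G, on [set: X] | gact X].
  by apply/subsetP=> g Gg; rewrite !inE Gg; apply/subsetP=> x; rewrite !inE.
have [_ _ ort cov] := orbit_transversalP nX.
rewrite -(repr_class_iso (perm_mod_iso F (gsubT nX))).
rewrite raddf_sum /= -big_enum.
rewrite (@perm_mod_class_orbits _ _ _ _ (enum (orbit_transversal (gact X) G setT))).
- by apply: eq_bigr => x _; rewrite burnside_repr_coset.
- exact: enum_uniq.
- by move=> x y; rewrite !mem_enum; apply: ort.
apply/setP=> x; rewrite inE big_enum; apply/bigcupP.
have [g Gg tx] := cov x (in_setT x).
by exists (gact X x g) => //; rewrite orbit_in_sym // mem_orbit.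
Qed.

End PermutationMap.

Definition perm_kernel (F : fieldType) : {pred burnside} :=
  [pred x | burnside_repr F x == 0].

End BurnsideGroup.

Arguments perm_kernel {gT} G F.

(* Main.v *)
From HB Require Import structures.
Require Import Defs.
From mathcomp Require Import all_boot all_fingroup all_order all_algebra.
From mathcomp Require Import all_solvable mxrepresentation character.
From mathcomp Require Import ring_quotient generic_quotient.
From mathcomp.classical Require Import boolp.
From mathcomp Require Import freeg.
From mathcomp Require Import zify.
(* The name repr_group is also that of a lemma of finite group theory. *)
Import Defs.

Set Implicit Arguments.
Unset Strict Implicit.
Unset Printing Implicit Defensive.

Import GRing.Theory.
Local Open Scope group_scope.
Local Open Scope ring_scope.
Local Open Scope quotient_scope.

(** Write m_L(x) for the number of fixed points of L on a G-set, extended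
    linearly to integral combinations x of G-sets; F is a field with p
    elements.

    Necessity of q | a.  If P is a p-group, normal in K, the rank of the
    natural map V^K -> V_P is additive in the F[G]-module V and invariant
    under isomorphism, and on F[X] it is the number of K-orbits in X^P: the
    sum of a K-orbit maps to zero unless the orbit lies in X^P.  If x lies
    in the kernel, these orbit numbers therefore vanish on x, and the
    Cauchy-Frobenius formula turns them into linear relations between the
    m_L(x) with P <= L <= K.  By induction on K, these give m_K(x) = 0 for
    every K with K/P cyclic (virtual_mark_hypo).  A (p,q)-Dress group G has
    such a K that is normal of q-power index.  A Sylow q-subgroup Q has KQ =
    G, so it acts on X^K with fixed points X^G, and a = m_G(x) = m_K(x) = 0
    modulo q.

    Existence for a = q.  Relations of G/N inflate to G
    (has_relation_quotient), and G has a quotient of one of two types: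
    elementary abelian of order q^2 with q <> p, or a semidirect product of
    C, of prime order different from p, and a nontrivial q-group Q acting
    faithfully on C (reduced_has_relation).  In both cases, relations come
    from a G-map
      F[G/1] + sum_j F[G/CD_j]  ->  F[G/C] + sum_j F[G/D_j]
    between modules of equal dimension, which is shown to be injective
    (normal_relation).  In the first case C = G, and the D_j are the q + 1
    subgroups of order q; this already has coefficient q at G/G.  In the
    second case |D| copies of the same D <= Q are used, with the j-th
    component twisted by the j-th power of a generator of C.  The resulting
    matrix is of Vandermonde type over F[C], with nodes the conjugates of
    the generator under D, which yields
      F[G/1] + |D| F[G/CD]  =  F[G/C] + |D| F[G/D].
    Take this for D = Q and for D = Q' of index q in Q.  The difference is
    |Q'| times a combination whose coefficient at G/G is q.  Division by
    |Q'| is possible because the group of F[G]-modules modulo direct sums is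
    torsion-free (repr_group_torsion_free), which is the Krull-Schmidt
    theorem. *)

(** * Homomorphisms out of the representation group *)

Section ReprGroup.

Variables (F : fieldType) (gT : finGroupType) (G : {group gT}).
Implicit Types (U V : representation F G) (x : repr_group F G).
Local Notation pi_repr := \pi_(Quotient.quot (@dsum_null_pred F gT G)).

Lemma pi_repr_zmod :
  zmod_morphism (pi_repr : free_repr F G -> repr_group F G).
Proof. exact: raddfB. Qed.

Section Lift.

Variables (A : zmodType) (f : representation F G -> A).
Hypothesis f_iso : forall U V, mx_rsim U V -> f U = f V.
Hypothesis f_add : forall U V, f (dadd_grepr U V) = f U + f V.

Definition free_lift : free_repr F G -> A :=
  @fglift _ (zmodule A) _ (f : {classic representation F G} -> zmodule A).

Lemma free_lift_is_zmod_morphism : zmod_morphism free_lift.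
Proof. exact: (@lift_is_additive _ _ (zmodule A)). Qed.
HB.instance Definition _ :=
  GRing.isZmodMorphism.Build (free_repr F G) A free_lift
    free_lift_is_zmod_morphism.

Lemma free_lift_gen U : free_lift (repr_gen U) = f U.
Proof. by rewrite /free_lift liftU scalezrE mulr1z. Qed.

Lemma free_lift_null z : dsum_null z -> free_lift z = 0.
Proof.
elim=> [U V /f_iso eqf | U V | | y {}z _ y0 _ z0].
- by rewrite raddfB /= !free_lift_gen eqf subrr.
- by rewrite raddfB raddfD /= !free_lift_gen f_add subrr.
- exact: raddf0.
by rewrite raddfB /= y0 z0 subrr.
Qed.

Definition repr_lift x : A := free_lift (repr x).

Lemma repr_lift_pi z : repr_lift (pi_repr z) = free_lift z.
Proof.
apply/eqP; rewrite -subr_eq0 -raddfB; apply/eqP/free_lift_null/asboolP.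
have /eqP := reprK (pi_repr z).
by rewrite -[_ == _]Quotient.idealrBE inE.
Qed.

Lemma repr_lift_is_zmod_morphism : zmod_morphism repr_lift.
Proof.
move=> x y; rewrite -[x]reprK -[y]reprK.
rewrite -[_ - _ in LHS]pi_repr_zmod.
by rewrite !repr_lift_pi raddfB.
Qed.
HB.instance Definition _ :=
  GRing.isZmodMorphism.Build (repr_group F G) A repr_lift
    repr_lift_is_zmod_morphism.

(** The universal property of the representation group. *)
Lemma repr_group_lift :
  exists phi : {additive repr_group F G -> A},
    forall U, phi (repr_class U) = f U.
Proof.
by exists repr_lift => U; rewrite /= repr_lift_pi free_lift_gen.
Qed.

End Lift.

Lemma repr_group_ind (Q : repr_group F G -> Prop) :
  Q 0 -> (forall U, Q (repr_class U)) ->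
  (forall x y, Q x -> Q y -> Q (x - y)) -> forall x, Q x.
Proof.
move=> Q0 QU QB x; rewrite -[x]reprK.
elim/freeg_ind_dom0: (repr x) => [|k U D _ _ QD].
  by rewrite -(subrr (0 : free_repr F G)) pi_repr_zmod subrr.
have QN y : Q y -> Q (- y) by rewrite -sub0r; apply: QB.
have QA y z : Q y -> Q z -> Q (y + z).
  by move=> Qy /QN; rewrite -{2}[z]opprK; apply: QB.
have QM n y : Q y -> Q (y *+ n).
  by move=> Qy; elim: n => // n IHn; rewrite mulrS; apply: QA.
rewrite [\pi _]raddfD /=; apply: QA => //.
have ->: << k *g U >> = repr_gen (U : representation F G) *~ k.
  by rewrite /repr_gen freegU_mulz intz.
rewrite [\pi _]raddfMz.
by case: k => n; rewrite ?NegzE ?mulrNz -?pmulrn; [|apply: QN];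
  apply: QM; apply: QU.
Qed.

End ReprGroup.

(** * Additive invariants from pairings of homomorphisms *)

(** A matrix f with al h *m f = f *m U h intertwines al with U, and
    composition with the g that intertwine U with be gives a pairing with
    values in matrices modulo J.  The index of the left radical in the group
    of all f turns direct sums into products.  With al and be trivial of
    degree 1 and J = 0, the radical is the kernel of the map from
    K-invariants to L-coinvariants; with al and be an indecomposable module
    and J the non-units of its endomorphism ring, the index measures the
    multiplicity of that module in U. *)
Section PairingIndex.

Variables (F : finFieldType) (gT : finGroupType) (G : {group gT}).
Variables (m n : nat) (K L : {set gT}).
Variables (al : gT -> 'M[F]_m) (be : gT -> 'M[F]_n).
Variable J : zmodClosed 'M[F]_(m, n).
Hypotheses (sKG : K \subset G) (sLG : L \subset G).
Implicit Types U V : representation F G.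

Definition hom_from U : {set 'M[F]_(m, rdegree U)} :=
  [set f | [forall h in K, al h *m f == f *m U h]].

Definition hom_to U : {set 'M[F]_(rdegree U, n)} :=
  [set g | [forall h in L, U h *m g == g *m be h]].

Definition hom_rad U : {set 'M[F]_(m, rdegree U)} :=
  [set f in hom_from U | [forall g in hom_to U, f *m g \in J]].

Lemma hom_fromP U f :
  reflect {in K, forall h, al h *m f = f *m U h} (f \in hom_from U).
Proof. by rewrite inE; apply: (iffP forall_inP) => Hf h /Hf /eqP. Qed.

Lemma hom_toP U g :
  reflect {in L, forall h, U h *m g = g *m be h} (g \in hom_to U).
Proof. by rewrite inE; apply: (iffP forall_inP) => Hg h /Hg /eqP. Qed.

Lemma hom_radP U f :
  reflect (f \in hom_from U /\ {in hom_to U, forall g, f *m g \in J})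
          (f \in hom_rad U).
Proof.
by apply: (iffP setIdP) => -[Hf] /forall_inP fg; split=> //; apply/forall_inP.
Qed.

Lemma hom_from_dadd U V f1 f2 :
  (row_mx f1 f2 \in hom_from (dadd_grepr U V)) =
    (f1 \in hom_from U) && (f2 \in hom_from V).
Proof.
apply/hom_fromP/andP=> [Hf | [/hom_fromP Hf1 /hom_fromP Hf2] h Kh]; last first.
  by rewrite mul_mx_row mul_row_block !mulmx0 addr0 add0r Hf1 ?Hf2.
by split; apply/hom_fromP=> h /Hf;
  rewrite mul_mx_row mul_row_block !mulmx0 addr0 add0r => /eq_row_mx[].
Qed.

Lemma hom_to_dadd U V g1 g2 :
  (col_mx g1 g2 \in hom_to (dadd_grepr U V)) =
    (g1 \in hom_to U) && (g2 \in hom_to V).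
Proof.
apply/hom_toP/andP=> [Hg | [/hom_toP Hg1 /hom_toP Hg2] h Lh]; last first.
  by rewrite /= mul_block_col mul_col_mx !mul0mx addr0 add0r Hg1 ?Hg2.
by split; apply/hom_toP=> h /Hg;
  rewrite /= mul_block_col mul_col_mx !mul0mx addr0 add0r => /eq_col_mx[].
Qed.

Lemma hom_to0 U : 0 \in hom_to U.
Proof. by apply/hom_toP=> h _; rewrite mulmx0 mul0mx. Qed.

Lemma hom_rad_dadd U V f1 f2 :
  (row_mx f1 f2 \in hom_rad (dadd_grepr U V)) =
    (f1 \in hom_rad U) && (f2 \in hom_rad V).
Proof.
apply/hom_radP/andP=> [[] | [/hom_radP[Hf1 fg1] /hom_radP[Hf2 fg2]]].
  rewrite hom_from_dadd => /andP[Hf1 Hf2] fg.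
  split; apply/hom_radP; split=> // g Hg.
    have := fg (col_mx g 0); rewrite hom_to_dadd Hg hom_to0 => /(_ isT).
    by rewrite mul_row_col mulmx0 addr0.
  have := fg (col_mx 0 g); rewrite hom_to_dadd Hg hom_to0 => /(_ isT).
  by rewrite mul_row_col mulmx0 add0r.
rewrite hom_from_dadd Hf1; split=> // g.
rewrite -[g]vsubmxK hom_to_dadd => /andP[/fg1 Hg1 /fg2 Hg2].
by rewrite mul_row_col rpredD.
Qed.

Lemma card_row_mx n1 n2 (A1 : {set 'M[F]_(m, n1)}) (A2 : {set 'M[F]_(m, n2)})
    (A : {set 'M[F]_(m, n1 + n2)}) :
  (forall f1 f2, (row_mx f1 f2 \in A) = (f1 \in A1) && (f2 \in A2)) ->
  #|A| = (#|A1| * #|A2|)%N.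
Proof.
move=> defA; rewrite -cardsX.
have inj_row :
    injective (fun f : 'M[F]_(m, n1) * 'M[F]_(m, n2) => row_mx f.1 f.2).
  by move=> [f1 f2] [g1 g2] /= /eq_row_mx[-> ->].
rewrite -(card_imset _ inj_row); congr #|pred_of_set _|; apply/setP=> f.
apply/idP/imsetP=> [|[[f1 f2]]]; rewrite ?inE /=.
  rewrite -[f]hsubmxK defA => /andP[fl fr].
  by exists (lsubmx f, rsubmx f) => //; rewrite inE /= fl.
by move=> f12 ->; rewrite defA.
Qed.

Lemma leq_hom_rsim U V : mx_rsim U V ->
  (#|hom_from U| <= #|hom_from V|)%N /\ (#|hom_rad U| <= #|hom_rad V|)%N.
Proof.
case=> B _ /row_freeP[B' BB'] simB.
have injB : injective (fun f : 'M[F]_(m, rdegree U) => f *m B).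
  by move=> f g /(congr1 (mulmx^~ B')); rewrite -!mulmxA BB' !mulmx1.
have fromB f : f \in hom_from U -> f *m B \in hom_from V.
  move=> /hom_fromP Hf; apply/hom_fromP=> h Kh.
  by rewrite mulmxA Hf // -!mulmxA simB // (subsetP sKG).
split; rewrite -(card_imset _ injB);
  apply/subset_leq_card/subsetP=> _ /imsetP[f Hf ->].
  exact: fromB.
have /hom_radP[Hf1 fg] := Hf; apply/hom_radP; split; first exact: fromB.
move=> g /hom_toP Hg; rewrite -mulmxA fg //; apply/hom_toP=> h Lh.
by rewrite mulmxA simB ?(subsetP sLG) // -!mulmxA Hg.
Qed.

(** The valuation at r turns the index into an additive invariant.  All
    primes r together determine the index, so it does not have to be shown
    to be a power of the characteristic. *)
Definition pairing_index r U : int :=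
  (logn r #|hom_from U|)%:Z - (logn r #|hom_rad U|)%:Z.

Lemma pairing_index_iso r U V :
  mx_rsim U V -> pairing_index r U = pairing_index r V.
Proof.
move=> simUV; have [le1 le2] := leq_hom_rsim simUV.
have [ge1 ge2] := leq_hom_rsim (mx_rsim_sym simUV).
rewrite /pairing_index; have -> : #|hom_from U| = #|hom_from V|.
  by apply/eqP; rewrite eqn_leq le1.
by have -> : #|hom_rad U| = #|hom_rad V| by apply/eqP; rewrite eqn_leq le2.
Qed.

Lemma card_hom_gt0 U : ((0 < #|hom_from U|) && (0 < #|hom_rad U|))%N.
Proof.
have f0 : 0 \in hom_from U by apply/hom_fromP=> h _; rewrite mulmx0 mul0mx.
rewrite !card_gt0; apply/andP; split; apply/set0Pn; exists 0 => //.
by apply/hom_radP; split=> // g _; rewrite mul0mx rpred0.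
Qed.

Lemma pairing_index_dadd r U V :
  pairing_index r (dadd_grepr U V) = pairing_index r U + pairing_index r V.
Proof.
have /andP[U1 U2] := card_hom_gt0 U; have /andP[V1 V2] := card_hom_gt0 V.
rewrite /pairing_index (card_row_mx (@hom_from_dadd U V)).
rewrite (card_row_mx (@hom_rad_dadd U V)) !lognM // !PoszD.
by rewrite opprD addrACA.
Qed.

End PairingIndex.

(** * Krull-Schmidt: the representation group is torsion-free *)

Section KrullSchmidt.

Variables (F : finFieldType) (gT : finGroupType) (G : {group gT}).
Implicit Types U V W : representation F G.

Definition repr_end U (e : 'M[F]_(rdegree U)) : Prop :=
  {in G, forall h, U h *m e = e *m U h}.

(** Idempotent endomorphisms correspond to direct sum decompositions; this
    form makes the decomposition of a module and the locality of its
    endomorphism ring equally direct. *)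
Definition indecomposable U : Prop :=
  (0 < rdegree U)%N /\
  forall e : 'M_(rdegree U), repr_end e -> e *m e = e -> e = 0 \/ e = 1%:M.

Lemma repr_endM U (e f : 'M_(rdegree U)) :
  repr_end e -> repr_end f -> repr_end (e *m f).
Proof. by move=> He Hf h Gh; rewrite mulmxA He // -!mulmxA Hf. Qed.

Lemma repr_endX U (e : 'M_(rdegree U)) k : repr_end e -> repr_end (e ^+ k).
Proof.
move=> He; elim: k => [|k IHk]; first by move=> h _; rewrite mulmx1 mul1mx.
by rewrite exprS; apply: repr_endM.
Qed.

Lemma repr_endV U (e : 'M_(rdegree U)) :
  e \in unitmx -> repr_end e -> repr_end (invmx e).
Proof.
move=> uE He h Gh; apply: (can_inj (mulKmx uE)); apply: (can_inj (mulmxK uE)).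
by rewrite mulKVmx // -!mulmxA mulVmx // mulmx1 -He.
Qed.

(** The powers of e form a finite set, so they are eventually periodic, say
    with period d from exponent i on; the exponent k is a multiple of d
    beyond i. *)
Lemma idempotent_power n (e : 'M[F]_n) :
  exists2 k, (0 < k)%N & e ^+ k *m e ^+ k = e ^+ k.
Proof.
have [i [j [lt_ij eq_ij]]] : exists i j : nat, (i < j)%N /\ e ^+ i = e ^+ j.
  pose f (i : 'I_#|{: 'M[F]_n}|.+1) := e ^+ i.
  have /injectivePn[i [j ne_ij eq_ij]] : ~~ injectiveb f.
    by apply/negP=> /injectiveP/leq_card; rewrite card_ord ltnn.
  have [lt_ij | lt_ji | eqij] := ltngtP i j; first by exists i, j.
    by exists j, i; rewrite lt_ji -/(f i) eq_ij.
  by case/eqP: ne_ij; apply: val_inj.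
pose d := (j - i)%N.
have per k t : (i <= k)%N -> e ^+ (k + t * d) = e ^+ k.
  move=> le_ik; elim: t => [|t IHt]; first by rewrite addn0.
  (* one period is absorbed through e ^+ i = e ^+ j, as j <= k + d *)
  rewrite mulSn addnCA [X in e ^+ X](_ : _ = (k - i + t * d) + j)%N; last by lia.
  rewrite exprD -eq_ij -exprD -[RHS]IHt; congr (e ^+ _); lia.
exists (i.+1 * d)%N; first by rewrite muln_gt0 subn_gt0.
rewrite -[_ *m _]exprD; apply: per.
by apply: leq_trans (leqnSn i) _; rewrite leq_pmulr ?subn_gt0.
Qed.

(** Fitting's lemma.  Over a finite field the idempotent that separates the
    unit part of e from its nilpotent part is a power of e. *)
Lemma end_unit_or_nilpotent U (e : 'M_(rdegree U)) :
  indecomposable U -> repr_end e ->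
  e \in unitmx \/ exists k, e ^+ k = 0 :> 'M_(rdegree U).
Proof.
move=> [_ indU] He; have [k k_gt0 idk] := idempotent_power e.
case: (indU _ (repr_endX k He) idk) => ek; [by right; exists k | left].
by move: ek; rewrite -(prednK k_gt0) exprS => /mulmx1_unit[].
Qed.

Section LocalEnd.

Variables (U : representation F G) (indU : indecomposable U).

Definition nonunit_end : {pred 'M[F]_(rdegree U)} :=
  [pred e | [forall h in G, U h *m e == e *m U h] && (e \notin unitmx)].

Lemma nonunit_endP (e : 'M_(rdegree U)) :
  reflect (repr_end e /\ e \notin unitmx) (e \in nonunit_end).
Proof.
apply: (iffP andP) => -[He nuE]; split=> //.
  by move=> h /(forall_inP He) /eqP.
by apply/forall_inP=> h /He ->.
Qed.

(** Locality of the endomorphism ring.  If f - g were a unit u, then u^-1 f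
    would be nilpotent, hence u^-1 f - 1 = u^-1 g a unit, and so would be g. *)
Lemma nonunit_end_zmod_closed : zmod_closed nonunit_end.
Proof.
split=> [|f g /nonunit_endP[Hf nuf] /nonunit_endP[Hg nug]].
  apply/nonunit_endP; split=> [h _|]; first by rewrite mulmx0 mul0mx.
  rewrite -row_free_unit /row_free mxrank0 eq_sym -lt0n; by case: indU.
have Hfg : repr_end (f - g) by move=> h Gh; rewrite mulmxBr mulmxBl Hf ?Hg.
apply/nonunit_endP; split=> //; apply: contra nug => u_fg.
have [|[k ak0]] :=
  end_unit_or_nilpotent indU (repr_endM (repr_endV u_fg Hfg) Hf).
  by rewrite unitmx_mul (negPf nuf) andbF.
have defg : g = (f - g) *m (invmx (f - g) *m f - 1%:M).
  by rewrite mulmxBr mulKVmx // mulmx1 opprB addrCA subrr addr0.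
rewrite defg unitmx_mul u_fg.
have := subrX1 (invmx (f - g) *m f) k; rewrite ak0 sub0r => /(congr1 -%R).
by rewrite opprK -mulrN => /esym /mulmx1_unit[].
Qed.

Definition nonunit_closed : zmodClosed 'M[F]_(rdegree U) :=
  HB.pack nonunit_end (GRing.isZmodClosed.Build _ _ nonunit_end_zmod_closed).

Definition multiplicity r V : int :=
  pairing_index G G U U nonunit_closed r V.

Lemma multiplicity_iso r V W :
  mx_rsim V W -> multiplicity r V = multiplicity r W.
Proof. exact: pairing_index_iso. Qed.

Lemma multiplicity_dadd r V W :
  multiplicity r (dadd_grepr V W) = multiplicity r V + multiplicity r W.
Proof. exact: pairing_index_dadd. Qed.

(** The identity of U is outside the radical. *)
Lemma multiplicity_self : exists r, multiplicity r U != 0.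
Proof.
pose hF := hom_from G U U; pose hR := hom_rad G G U U nonunit_closed U.
have id_from : 1%:M \in hF by apply/hom_fromP=> h _; rewrite mulmx1 mul1mx.
have ltRF : (#|hR| < #|hF|)%N.
  apply/proper_card/properP; split; first by apply/subsetP=> f /hom_radP[].
  exists 1%:M => //; apply/negP=> /hom_radP[_ /(_ 1%:M)].
  rewrite mulmx1; have -> : 1%:M \in hom_to G U U.
    by apply/hom_toP=> h _; rewrite mulmx1 mul1mx.
  by case/(_ isT)/nonunit_endP; rewrite unitmx1.
apply: contrapT => mult0; move: ltRF; apply/negP; rewrite -leqNgt.
have /andP[F0 R0] := card_hom_gt0 G G U U nonunit_closed U.
rewrite (@eqn_from_log #|hR| #|hF|) // => r.
apply: contra_notP mult0 => /eqP neq; exists r; apply: contra neq.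
by rewrite subr_eq0 eq_sym.
Qed.

(** If U -> V -> U were an automorphism, then U would be a direct summand of
    V, hence all of V. *)
Lemma multiplicity_other r V :
  indecomposable V -> ~ mx_rsim U V -> multiplicity r V = 0.
Proof.
move=> [V_gt0 indV] not_iso; rewrite /multiplicity /pairing_index.
suff -> : hom_rad G G U U nonunit_closed V = hom_from G U V by rewrite subrr.
apply/setP=> f; apply/idP/idP=> [/hom_radP[]//|Hf].
apply/hom_radP; split=> // g Hg.
have Uf : {in G, forall h, U h *m f = f *m V h} by apply/hom_fromP.
have Vg : {in G, forall h, V h *m g = g *m U h} by apply/hom_toP.
have Hfg : repr_end (f *m g) by move=> h Gh; rewrite mulmxA Uf // -!mulmxA Vg.
apply/nonunit_endP; split=> //; apply/negP=> u_fg; apply: not_iso.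
pose e := g *m invmx (f *m g) *m f.
have He : repr_end e.
  move=> h Gh; rewrite /e !mulmxA Vg // -(mulmxA g (U h)).
  by rewrite (repr_endV u_fg Hfg) // -!mulmxA Uf.
have ide : e *m e = e.
  rewrite /e -!mulmxA [f *m (g *m _)]mulmxA [invmx _ *m (_ *m _)]mulmxA.
  by rewrite mulVmx // mul1mx.
have rfg : \rank (f *m g) = rdegree U.
  by apply/eqP; rewrite -row_free_unit in u_fg.
have freef : row_free f.
  by rewrite /row_free eqn_leq rank_leq_row -{1}rfg mxrankM_maxl.
case: (indV e He ide) => e01.
  have : f *m e *m g = f *m g by rewrite /e !mulmxA mulmxV // mul1mx.
  rewrite e01 mulmx0 mul0mx => fg0; move: u_fg.
  rewrite -fg0 -row_free_unit /row_free mxrank0 eq_sym; case: indU => U_gt0 _.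
  by rewrite (gtn_eqF U_gt0).
exists f => //; apply/eqP; rewrite eqn_leq; apply/andP; split.
  by rewrite -rfg (leq_trans (mxrankM_maxl _ _)) ?rank_leq_col.
rewrite -(mxrank1 F (rdegree V)) -e01.
by rewrite (leq_trans (mxrankM_maxr _ _)) ?rank_leq_row.
Qed.

End LocalEnd.

Lemma repr_class_rdegree0 U : rdegree U = 0%N -> repr_class U = 0.
Proof.
move=> U0; apply/(addrI (repr_class U)); rewrite addr0 -repr_class_add.
apply: repr_class_iso; exists 0 => [||h _]; last by rewrite mulmx0 mul0mx.
  by rewrite /= U0.
by rewrite /row_free mxrank0 /= U0.
Qed.

Lemma idempotent_split U (e : 'M_(rdegree U)) :
    repr_end e -> e *m e = e -> e <> 0 -> e <> 1%:M ->
  exists V W, [/\ repr_class U = repr_class V + repr_class W,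
    (rdegree V < rdegree U)%N & (rdegree W < rdegree U)%N].
Proof.
move=> He ide ne0 ne1; pose e' : 'M_(rdegree U) := 1%:M - e.
have e'e : e' *m e = 0 by rewrite /e' mulmxBl mul1mx ide subrr.
have modE : mxmodule U e.
  by apply/mxmoduleP=> h Gh; rewrite -He // submxMl.
have modE' : mxmodule U e'.
  apply/mxmoduleP=> h Gh; rewrite mulmxBl mul1mx -He //.
  by rewrite -{1}[U h]mulmx1 -mulmxBr submxMl.
have sum1 : (e + e' :=: 1%:M)%MS.
  apply/eqmxP; rewrite submx1 /=.
  by rewrite -[X in (X <= _)%MS](subrKC e 1%:M) addmx_sub_adds.
have dx : mxdirect (e + e').
  apply/mxdirect_addsP/eqP; rewrite -submx0; apply/rV_subP=> v.
  rewrite sub_capmx => /andP[/submxP[x ->] /submxP[y]] => xy.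
  by rewrite -ide mulmxA xy -mulmxA e'e mulmx0 sub0mx.
have mod1 : mxmodule U 1%:M by apply: mxmodule1.
exists (Representation (submod_repr modE)).
exists (Representation (submod_repr modE')).
split=> /=.
- rewrite -repr_class_add; apply: repr_class_iso.
  apply: mx_rsim_trans (mx_rsim_sym (rsim_submod1 mod1 (eqmx_refl _))) _.
  by apply: (mx_rsim_dadd (modU := modE) (modV := modE') mod1 sum1 dx);
    apply: mx_rsim_refl.
- rewrite ltn_neqAle rank_leq_row andbT; apply: contra_notN ne1 => re.
  have uE : e \in unitmx by rewrite -row_free_unit.
  by apply: (can_inj (mulKmx uE)); rewrite ide mulmx1.
rewrite ltn_neqAle rank_leq_row andbT; apply: contra_notN ne0 => re.
have uE : e' \in unitmx by rewrite -row_free_unit.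
by apply: (can_inj (mulKmx uE)); rewrite e'e mulmx0.
Qed.

Definition indec_comb (s : seq (representation F G * int)) : repr_group F G :=
  \sum_(i <- s) repr_class i.1 *~ i.2.

Definition all_indec (s : seq (representation F G * int)) : Prop :=
  forall i, List.In i s -> indecomposable i.1.

Lemma repr_class_indec U : exists2 s, all_indec s & repr_class U = indec_comb s.
Proof.
have [n leUn] := ubnP (rdegree U); elim: n => // n IHn in U leUn *.
have [U0 | U_gt0] := posnP (rdegree U).
  by exists [::] => //; rewrite /indec_comb big_nil repr_class_rdegree0.
have [indU | not_ind] := pselect (indecomposable U).
  exists [:: (U, 1)]; first by move=> i [<-|[]].
  by rewrite /indec_comb big_seq1 mulr1z.
have [e [He ide ne0 ne1]] : exists e : 'M_(rdegree U),
    [/\ repr_end e, e *m e = e, e <> 0 & e <> 1%:M].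
  apply: contrapT => noe; apply: not_ind; split=> // e He ide.
  by apply: contrapT => /not_orP[ne0 ne1]; apply: noe; exists e.
have [V [W [-> ltV ltW]]] := idempotent_split He ide ne0 ne1.
have [s1 s1P ->] := IHn V (leq_trans ltV leUn).
have [s2 s2P ->] := IHn W (leq_trans ltW leUn).
exists (s1 ++ s2); last by rewrite /indec_comb big_cat.
by move=> i /List.in_app_iff[/s1P | /s2P].
Qed.

Lemma repr_group_indec (x : repr_group F G) :
  exists2 s, all_indec s & x = indec_comb s.
Proof.
elim/repr_group_ind: x => [|U|x y [s1 s1P ->] [s2 s2P ->]].
- by exists [::] => //; rewrite /indec_comb big_nil.
- exact: repr_class_indec.
exists (s1 ++ [seq (i.1, - i.2) | i <- s2]).
  move=> i /List.in_app_iff[/s1P // | /List.in_map_iff[j [<- /s2P]]] //.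
rewrite /indec_comb big_cat big_map /= -sumrN; congr (_ + _).
by apply: eq_bigr => i _; rewrite mulrNz.
Qed.

(** Write x as a combination of indecomposable modules and collect the terms
    isomorphic to the first one, U.  The multiplicity of U is an additive
    invariant that only sees the collected coefficient d, so N d = 0 and d =
    0; the other terms form a shorter combination. *)
Theorem repr_group_torsion_free (x : repr_group F G) (N : int) :
  N != 0 -> x *~ N = 0 -> x = 0.
Proof.
move=> nzN; have [s sP ->] := repr_group_indec x.
have [n] := ubnP (size s); elim: n => // n IHn in s sP *.
case: s sP => [|[U c] s] sP /= les xN0; first by rewrite /indec_comb big_nil.
pose isoU (i : representation F G * int) := `[< mx_rsim U i.1 >].
pose s' := [seq i <- s | ~~ isoU i].
pose d := c + \sum_(i <- s | isoU i) i.2.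
have indU : indecomposable U by apply: (sP (U, c)); left.
have defx : indec_comb ((U, c) :: s) = repr_class U *~ d + indec_comb s'.
  rewrite /d /indec_comb big_cons (bigID isoU) /= big_filter addrA mulrzDr.
  congr (_ + _ + _); rewrite mulrz_sumr; apply: eq_bigr => i /asboolP iso.
  by rewrite (repr_class_iso iso).
have s'P : all_indec s'.
  by move=> i /List.filter_In[si _]; apply: sP; right.
suff d0 : d = 0.
  move: xN0; rewrite defx d0 mulr0z add0r; apply: IHn => //.
  by rewrite size_filter (leq_ltn_trans (count_size _ _)).
have [r mUU] := multiplicity_self indU.
have [mult multP] :=
  repr_group_lift (multiplicity_iso indU r) (multiplicity_dadd indU r).
have map_comb t :
    mult (indec_comb t) = \sum_(i <- t) multiplicity indU r i.1 *~ i.2.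
  by rewrite raddf_sum; apply: eq_bigr => i _; rewrite raddfMz -multP.
have mult_s' : mult (indec_comb s') = 0.
  have s'0 i : List.In i s' -> multiplicity indU r i.1 = 0.
    move=> s'i; apply: multiplicity_other; first exact: s'P.
    by have /List.filter_In[_ /asboolP] := s'i.
  rewrite map_comb; elim: (s') s'0 => [|i t IHt] t0; first by rewrite big_nil.
  rewrite big_cons t0 ?mul0rz ?add0r ?IHt; [by [] | | by left].
  by move=> j tj; apply: t0; right.
move/(congr1 mult): xN0.
rewrite defx raddfMz raddfD raddfMz /= mult_s' multP raddf0 addr0.
move/eqP; rewrite -!mulrzA mulrz_eq0 (negPf mUU) orbF.
by rewrite mulf_eq0 (negPf nzN) orbF => /eqP.
Qed.

End KrullSchmidt.

(** * Orbits on fixed points as an invariant of permutation modules *)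

Lemma acts_afix_normal (gT : finGroupType) (G K P : {group gT}) (X : gset G) :
  K \subset G -> P <| K -> [acts K, on 'Fix_(gact X)(P) | gact X].
Proof.
move=> sKG /andP[sPK nPK]; have sPG := subset_trans sPK sKG.
apply/subsetP=> h Kh; have Gh := subsetP sKG h Kh; rewrite inE Gh inE.
apply/subsetP=> x /afixP Fx; rewrite inE; apply/afixP=> k Pk.
have Pkh : (k ^ h^-1)%g \in P by rewrite memJ_norm // groupV (subsetP nPK).
rewrite -actMin ?(subsetP sPG k) // conjgCV.
by rewrite actMin ?(subsetP sPG _ Pkh) ?(Fx _ Pkh).
Qed.

Section PermutationIndex.

Variables (p : nat) (F : finFieldType) (gT : finGroupType) (G : {group gT}).
Hypotheses (p_pr : prime p) (cardF : #|F| = p) (charF : p%:R = 0 :> F).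

Lemma zero_mx_zmod_closed m n : zmod_closed (pred1 (0 : 'M[F]_(m, n))).
Proof. by split=> [|f g /eqP-> /eqP->]; rewrite inE ?subrr. Qed.

Definition zero_mx_closed m n : zmodClosed 'M[F]_(m, n) :=
  HB.pack (pred1 (0 : 'M[F]_(m, n)) : {pred _})
    (GRing.isZmodClosed.Build _ _ (zero_mx_zmod_closed m n)).

Local Notation triv1 := (fun _ : gT => 1%:M : 'M[F]_1).

Variable X : gset G.
Local Notation to := (gact X).

Lemma row_perm_mod h (f : 'rV[F]_(rdegree (perm_mod F X))) x : h \in G ->
  (f *m perm_mod F X h) 0 (enum_rank x) = f 0 (enum_rank (to x h^-1%g)).
Proof.
move=> Gh; rewrite mxE.
transitivity (\sum_i (to x h^-1%g == enum_val i)%:R * f 0 i).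
  apply: eq_bigr => i _; rewrite mxE enum_rankK mulrC; congr (_%:R * _).
  by rewrite -(inj_eq (act_inj to h) _ (enum_val i)) actKVin // eq_sym.
by rewrite (sum_indicator enum_valK enum_rankK).
Qed.

Lemma perm_mod_col h (g : 'cV[F]_(rdegree (perm_mod F X))) x :
  (perm_mod F X h *m g) (enum_rank x) 0 = g (enum_rank (to x h)) 0.
Proof.
rewrite mxE -(sum_indicator enum_valK enum_rankK _ (fun i => g i 0)).
by apply: eq_bigr => i _; rewrite mxE enum_rankK.
Qed.

(** Such a row is an arbitrary function on the set of K-orbits in S. *)
Lemma card_invariant_rows (K : {group gT}) (S : {set X}) :
  K \subset G -> [acts K, on S | to] ->
  #|[set f : 'rV[F]_#|X| |
      [forall h in K, forall x, f 0 (enum_rank (to x h)) == f 0 (enum_rank x)]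
      && [forall x, (x \notin S) ==> (f 0 (enum_rank x) == 0)]]|
    = (p ^ #|orbit to K @: S|)%N.
Proof.
move=> sKG nSK; pose O := orbit to K @: S.
have memO x : (orbit to K x \in O) = (x \in S).
  apply/imsetP/idP=> [[y Sy eq_xy] | Sx]; last by exists x.
  have: x \in orbit to K y by rewrite -eq_xy orbit_refl.
  by case/orbitP=> h Kh <-; rewrite (acts_act nSK).
pose row (psi : {ffun {set X} -> F}) : 'rV[F]_#|X| :=
  \row_i psi (orbit to K (enum_val i)).
have rowE psi x : row psi 0 (enum_rank x) = psi (orbit to K x).
  by rewrite mxE enum_rankK.
transitivity #|pffun_on (0 : F) O predT|; last by rewrite card_pffun_on cardF.
have inj_row : {in pffun_on (0 : F) (mem O) predT &, injective row}.
  move=> psi1 psi2 /pffun_onP[/supportP psi1P _].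
  move=> /pffun_onP[/supportP psi2P _] eq12.
  apply/ffunP=> A; have [/imsetP[x _ ->] | nA] := boolP (A \in O).
    by rewrite -!rowE eq12.
  by rewrite psi1P ?psi2P.
rewrite -(card_in_imset inj_row); apply: eq_card => f; rewrite inE.
apply/andP/imsetP=>
  [[/forall_inP fK /forallP fS] | [psi /pffun_onP[/supportP psiP _] ->]].
  pose psi0 (A : {set X}) : F :=
    if [pick x in A | (A == orbit to K x) && (x \in S)] is Some x
    then f 0 (enum_rank x) else 0.
  pose psi : {ffun {set X} -> F} := finfun psi0.
  have finv x y : x \in orbit to K y -> f 0 (enum_rank x) = f 0 (enum_rank y).
    by case/orbitP=> h /fK /forallP /(_ y) /eqP <- <-.
  exists psi.
    apply/pffun_onP; split=> //; apply/supportP=> A nA; rewrite ffunE /psi0.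
    by case: pickP => // x /and3P[_ /eqP defA Sx]; rewrite defA memO Sx in nA.
  apply/rowP=> i; rewrite -[i]enum_valK rowE ffunE /psi0.
  case: pickP => [x /and3P[_ /eqP defA Sx] | noA].
    by apply: finv; rewrite -defA orbit_refl.
  apply/eqP; have /implyP := fS (enum_val i); apply; apply/negP=> Si.
  by have := noA (enum_val i); rewrite orbit_refl eqxx Si.
split; last first.
  by apply/forallP=> x; apply/implyP=> nSx; rewrite rowE psiP ?memO.
by apply/forall_inP=> h Kh; apply/forallP=> x; rewrite !rowE orbit_act_in.
Qed.

(** Each level set of u is P-stable, so its cardinality agrees modulo p with
    that of its P-fixed part. *)
Lemma sum_pgroup_invariant (P : {group gT}) (u : X -> F) :
    P \subset G -> p.-group P ->
    (forall h x, h \in P -> u (to x h) = u x) ->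
  \sum_x u x = \sum_(x in 'Fix_to(P)) u x.
Proof.
move=> sPG pP uP.
pose S v := [set x | u x == v].
have nSP v : [acts P, on S v | to].
  apply/subsetP=> h Ph; rewrite inE (subsetP sPG) //.
  by rewrite inE; apply/subsetP=> x; rewrite !inE uP.
have sumS (A : {set X}) : \sum_(x in A) u x = \sum_v v *+ #|A :&: S v|.
  rewrite (partition_big u predT) //=; apply: eq_bigr => v _.
  rewrite -sumr_const; apply: eq_big => [x | x /andP[_ /eqP] //].
  by rewrite !inE.
transitivity (\sum_(x in [set: X]) u x).
  by apply: eq_bigl => x; rewrite inE.
rewrite !sumS; apply: eq_bigr => v _; rewrite setTI setIC.
have /(congr1 (fun n => n%:R : F)) := pgroup_fix_mod pP (nSP v).
have modF n : (n %% p)%:R = n%:R :> F.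
  by rewrite {2}(divn_eq n p) natrD natrM charF mulr0 add0r.
by rewrite !modF -[v *+ _]mulr_natr -[v *+ #|_ :&: _|]mulr_natr => ->.
Qed.

(** The pairing of a K-invariant row f with a P-invariant column only
    depends on the values of f on X^P, and the indicator of a point of X^P
    is P-invariant. So the radical consists of the invariant functions that
    vanish on X^P, and the index is p to the number of K-orbits in X^P. *)
Lemma pairing_index_perm_mod (K P : {group gT}) :
    K \subset G -> P <| K -> p.-group P ->
  pairing_index K P triv1 triv1 (zero_mx_closed 1 1) p (perm_mod F X)
    = #|orbit to K @: 'Fix_to(P)|%:Z.
Proof.
move=> sKG /andP[sPK nPK] pP; have sPG := subset_trans sPK sKG.
have nTK : [acts K, on [set: X] | to].
  apply/subsetP=> h Kh; rewrite !inE (subsetP sKG) //.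
  by apply/subsetP=> x; rewrite !inE.
have nFK : [acts K, on 'Fix_to(P) | to].
  by apply: acts_afix_normal; rewrite /normal ?sPK.
have nF'K : [acts K, on ~: 'Fix_to(P) | to] by rewrite -setTD actsD.
have invE f : f \in hom_from K triv1 (perm_mod F X) =
    [forall h in K, forall x, f 0 (enum_rank (to x h)) == f 0 (enum_rank x)].
  apply/hom_fromP/forall_inP=> [Hf h Kh | Hf h Kh].
    apply/forallP=> x; have := Hf h Kh; rewrite mul1mx => {1}->.
    by rewrite row_perm_mod ?actKin ?(subsetP sKG).
  rewrite mul1mx; apply/rowP=> i.
  rewrite -[i]enum_valK row_perm_mod ?(subsetP sKG) //.
  by have /forallP/(_ (enum_val i))/eqP := Hf _ (groupVr Kh).
have card_from : #|hom_from K triv1 (perm_mod F X)| =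
    (p ^ #|orbit to K @: [set: X]|)%N.
  rewrite -(card_invariant_rows sKG nTK); apply: eq_card => f; rewrite invE inE.
  by rewrite andbC (introT forallP) // => x; rewrite inE.
have card_rad :
    #|hom_rad K P triv1 triv1 (zero_mx_closed 1 1) (perm_mod F X)| =
      (p ^ #|orbit to K @: ~: 'Fix_to(P)|)%N.
  rewrite -(card_invariant_rows sKG nF'K); apply: eq_card => f.
  rewrite [RHS]inE -invE.
  apply/hom_radP/andP=> -[Hf Hg]; split=> //.
    apply/forallP=> x; rewrite inE negbK; apply/implyP=> Fx.
    pose g : 'cV[F]_#|X| := \col_i (enum_val i == x)%:R.
    have /Hg/eqP/(congr1 (fun M : 'M_1 => M 0 0)) :
        g \in hom_to P triv1 (perm_mod F X).
      apply/hom_toP=> h Ph; rewrite mulmx1; apply/colP=> i.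
      rewrite -[i]enum_valK.
      rewrite perm_mod_col !mxE !enum_rankK.
      by rewrite -[in LHS](afixP Fx h Ph) (inj_eq (act_inj to h)).
    rewrite mxE (bigD1 (enum_rank x)) //= big1 => [|i].
      by rewrite !mxE enum_rankK eqxx mulr1 addr0 => ->.
    rewrite !mxE -(inj_eq enum_val_inj) enum_rankK => /negPf->.
    by rewrite mulr0.
  move=> g Pg; apply/eqP/matrixP=> i j; rewrite !ord1 !mxE.
  pose u x := f 0 (enum_rank x) * g (enum_rank x) 0.
  transitivity (\sum_x u x).
    have bij_enum := onW_bij (mem xpredT) (enum_val_bij (gcarrier X)).
    rewrite [RHS](reindex _ bij_enum) /=.
    by apply: eq_bigr => k _; rewrite /u enum_valK.
  rewrite (sum_pgroup_invariant sPG pP) => [|h x Ph].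
    apply: big1 => x Fx; rewrite /u.
    by have /forallP/(_ x) := Hg; rewrite inE Fx => /eqP->; rewrite mul0r.
  move: Hf; rewrite invE => /forall_inP /(_ h (subsetP sPK _ Ph)).
  move=> /forallP /(_ x) /eqP; rewrite /u => ->; congr (_ * _).
  have /hom_toP/(_ h Ph) := Pg; rewrite mulmx1 => {2}<-.
  by rewrite perm_mod_col.
rewrite /pairing_index card_from card_rad !pfactorK //.
have -> : #|orbit to K @: [set: X]| =
    (#|orbit to K @: 'Fix_to(P)| + #|orbit to K @: ~: 'Fix_to(P)|)%N.
  rewrite -(setUCr 'Fix_to(P)) imsetU cardsU disjoint_setI0 ?cards0 ?subn0 //.
  rewrite -setI_eq0; apply/eqP/setP=> A; rewrite !inE; apply/andP=> -[].
  case/imsetP=> x Fx ->{A} /imsetP[y]; rewrite inE => /negP nFy eq_xy.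
  apply: nFy.
  have /orbitP[h Kh <-]: y \in orbit to K x by rewrite eq_xy orbit_refl.
  by rewrite (acts_act nFK).
by rewrite PoszD addrK.
Qed.

End PermutationIndex.

(** * The marks of a relation vanish at p-hypo-elementary subgroups *)

Section Marks.

Variables (p : nat) (F : finFieldType) (gT : finGroupType) (G : {group gT}).
Hypotheses (p_pr : prime p) (cardF : #|F| = p) (charF : p%:R = 0 :> F).
Variables (I : finType) (X : I -> gset G) (c : I -> int).
Hypothesis relX : \sum_i repr_class (perm_mod F (X i)) *~ c i = 0.

Definition virtual_mark (L : {group gT}) : int :=
  \sum_i #|'Fix_(gact (X i))(L)|%:Z * c i.

Lemma virtual_orbits0 (K P : {group gT}) :
    K \subset G -> P <| K -> p.-group P ->
  \sum_i #|orbit (gact (X i)) K @: 'Fix_(gact (X i))(P)|%:Z * c i = 0.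
Proof.
move=> sKG nPK pP; have sPG := subset_trans (normal_sub nPK) sKG.
pose one_mx (g : gT) : 'M[F]_1 := 1%:M.
have [phi phiE] := repr_group_lift
  (pairing_index_iso one_mx one_mx (zero_mx_closed F 1 1) sKG sPG p)
  (pairing_index_dadd K P one_mx one_mx (zero_mx_closed F 1 1) p).
have := congr1 phi relX; rewrite raddf0 raddf_sum => rel0; rewrite -[RHS]rel0.
apply: eq_bigr => i _; rewrite raddfMz phiE (@pairing_index_perm_mod p) //.
by rewrite [RHS]mulrzz.
Qed.

(** The Cauchy-Frobenius formula for the action of K on X^P: the points of
    X^P fixed by k are those fixed by P and k together. *)
Lemma sum_virtual_marks (K P : {group gT}) :
    K \subset G -> P <| K -> p.-group P ->
  \sum_(k in K) virtual_mark (P <*> <[k]>)%G = 0.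
Proof.
move=> sKG nPK pP; have [sPK nPK'] := andP nPK.
have /(congr1 (fun x => x * #|K|%:Z)) := virtual_orbits0 sKG nPK pP.
rewrite mul0r exchange_big /= => orb0; rewrite -[RHS]orb0.
rewrite mulr_suml; apply: eq_bigr => i _; rewrite -mulr_suml mulrAC.
congr (_ * _).
have nFK : [acts K, on 'Fix_(gact (X i))(P) | gact (X i)].
  exact: acts_afix_normal.
rewrite -PoszM -Frobenius_Cauchy // (big_morph Posz PoszD (erefl 0%:Z)).
apply: eq_bigr => k Kk; congr Posz; apply: eq_card => x.
by rewrite afixYin ?afix_cycle_in ?cycle_subG ?(subsetP sKG) ?(subset_trans sPK).
Qed.

(** In the sum of the marks of <P, k> over k in K, the subgroups <P, k>
    other than K contribute zero by induction; some k has <P, k> = K since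
    K/P is cyclic, so a positive multiple of the mark of K vanishes. *)
Lemma virtual_mark_hypo (K P : {group gT}) :
    K \subset G -> P <| K -> p.-group P -> cyclic (K / P) ->
  virtual_mark K = 0.
Proof.
have [n] := ubnP #|K|; elim: n => // n IHn in K * => leKn sKG nPK pP cycKP.
have [sPK nPK'] := andP nPK.
have sLK k : k \in K -> P <*> <[k]> \subset K.
  by move=> Kk; rewrite join_subG sPK cycle_subG.
have := sum_virtual_marks sKG nPK pP.
pose isK k := (P <*> <[k]>)%g == K.
rewrite (bigID isK) /= [X in _ + X]big1 => [|k /andP[Kk neqK]]; last first.
  have pLK : P <*> <[k]> \proper K by rewrite properEneq neqK sLK.
  apply: IHn => //.
  - exact: leq_trans (proper_card pLK) leKn.
  - exact: subset_trans (sLK k Kk) sKG.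
  - by apply: normalS nPK; rewrite ?joing_subl ?sLK.
  by apply: cyclicS cycKP; apply: quotientS; apply: sLK.
rewrite addr0.
rewrite (eq_bigr (fun=> virtual_mark K)) => [|k /andP[_ /eqP defK]]; last first.
  by congr virtual_mark; apply: val_inj.
rewrite sumr_const => /eqP; rewrite Num.Theory.mulrn_eq0.
case/orP=> [/eqP/card0_eq noK | /eqP//].
have /cyclicP[xP defKP] := cycKP.
have /morphimP[x nPx Kx def_xP] : xP \in (K / P)%g.
  by rewrite defKP cycle_id.
have := noK x; rewrite unfold_in Kx /isK => /eqP[]; apply/eqP.
rewrite norm_joinEr ?cycle_subG // -quotientK ?cycle_subG // quotient_cycle //.
by rewrite -def_xP -defKP quotientGK.
Qed.

End Marks.

(** * Marks at G and at a normal subgroup of q-power index *)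

Lemma mul_Sylow_index (q : nat) (gT : finGroupType) (G C Q : {group gT}) :
  C <| G -> q.-nat #|G : C|%g -> q.-Sylow(G) Q -> (C * Q)%g = G.
Proof.
move=> /andP[sCG nCG] qGC sylQ; have sQG := pHall_sub sylQ.
have qGq : q.-group (G / C) by rewrite /pgroup card_quotient.
have nCQ := subset_trans sQG nCG.
have sylQC := quotient_pHall nCQ sylQ.
have defGC : (Q / C)%g = (G / C)%g by apply: (pHall_id sylQC).
apply/eqP; rewrite eqEsubset mul_subG //=.
by rewrite -quotientSK // defGC.
Qed.

Section CoefficientDivisible.

Variables (p q : nat) (F : finFieldType) (gT : finGroupType) (G : {group gT}).
Hypotheses (p_pr : prime p) (cardF : #|F| = p) (charF : p%:R = 0 :> F).

(** A Sylow q-subgroup Q of G satisfies CQ = G, so the fixed points of Q on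
    X^C are X^G, and the marks at C and at G agree modulo q; the mark at C
    is zero. *)
Lemma dvdz_virtual_mark (I : finType) (X : I -> gset G) (c : I -> int)
    (C P : {group gT}) :
    \sum_i repr_class (perm_mod F (X i)) *~ c i = 0 ->
    C <| G -> q.-nat #|G : C|%g -> P <| C -> p.-group P -> cyclic (C / P) ->
  (q %| virtual_mark X c G)%Z.
Proof.
move=> relX nCG qGC nPC pP cycCP; have sCG := normal_sub nCG.
have markC := virtual_mark_hypo p_pr cardF charF relX sCG nPC pP cycCP.
rewrite -[virtual_mark X c G]subr0 -markC -sumrB; apply: rpred_sum => i _.
rewrite -mulrBl; apply: dvdz_mulr.
have [Q sylQ] := Sylow_exists q G; have sQG := pHall_sub sylQ.
have nFQ : [acts Q, on 'Fix_(gact (X i))(C) | gact (X i)].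
  by apply: subset_trans sQG _; apply: acts_afix_normal (subxx G) nCG.
have /eqP := pgroup_fix_mod (pHall_pgroup sylQ) nFQ.
rewrite -afixMin // (mul_Sylow_index nCG qGC sylQ) eq_sym.
by rewrite -eqz_mod_dvd !modz_nat.
Qed.

End CoefficientDivisible.

(** H x is fixed by G only if G is contained in a conjugate of H. *)
Lemma card_afix_cosets (gT : finGroupType) (G H : {group gT}) : H \subset G ->
  #|'Fix_(gact (cosets G H))(G)| = (H :==: G) :> nat.
Proof.
move=> sHG; have fixP (A : cosets G H) :
    (A \in 'Fix_(gact (cosets G H))(G)) = (H :==: G).
  have /rcosetsP[x Gx defA] := valP A; apply/idP/eqP=> [/afixP fixA | defH].
    apply/eqP; rewrite eqEcard sHG -(cardJg H x) subset_leq_card //.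
    rewrite -sub_afixRs_norms -defA; apply/afixP=> g Gg.
    by rewrite -(val_gsub A Gg) fixA.
  apply/afixP=> g Gg; apply: val_inj; rewrite (val_gsub A Gg) defA /= rcosetE.
  by rewrite -rcosetM defH !rcoset_id ?groupM.
have [eqHG | neqHG] := eqVneq (H : {set gT}) G; last first.
  by apply: eq_card0 => A; rewrite fixP (negPf neqHG).
transitivity #|cosets G H|; last by rewrite card_gsub -/#|G : H| eqHG indexgg.
by apply: eq_card => A; rewrite fixP eqHG eqxx.
Qed.

(** * Coset spaces and disjoint unions of them *)

Section CosetPoints.

Variables (gT : finGroupType) (G H : {group gT}).
Hypothesis sHG : H \subset G.

Lemma card_cosets : #|cosets G H| = #|G : H|%g.
Proof. exact: card_gsub. Qed.

Lemma rcosets_base : gval H \in rcosets H G.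
Proof. by apply/rcosetsP; exists 1%g; rewrite ?mulg1. Qed.

Definition base_coset : cosets G H :=
  exist (fun A => A \in rcosets H G) (gval H) rcosets_base.

(** Points of cosets G H carry a proof of membership; coset_pt avoids it by
    using H itself as value for x outside G. *)
Definition coset_pt (x : gT) : cosets G H := insubd base_coset (H :* x).

Lemma val_coset_pt x : x \in G -> val (coset_pt x) = H :* x.
Proof. by move=> Gx; rewrite insubdK // mem_rcosets mulSGid. Qed.

Lemma coset_pt_eq x y : x \in G -> y \in G ->
  (coset_pt x == coset_pt y) = (x * y^-1 \in H)%g.
Proof.
move=> Gx Gy; rewrite -val_eqE !val_coset_pt // -mem_rcoset.
by apply/eqP/idP=> [<- | /rcoset_eqP //]; rewrite rcoset_refl.
Qed.

Lemma coset_ptM x g : x \in G -> g \in G ->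
  gact (cosets G H) (coset_pt x) g = coset_pt (x * g)%g.
Proof.
move=> Gx Gg; apply: val_inj; rewrite (val_gsub (coset_pt x) Gg).
by rewrite !val_coset_pt ?groupM //= rcosetE rcosetM.
Qed.

Definition coset_rep (A : cosets G H) : gT := fingroup.repr (val A).

Lemma coset_rep_in A : coset_rep A \in G.
Proof.
have /rcosetsP[x Gx defA] := valP A; rewrite /coset_rep defA.
have /rcosetP[h Hh ->] := mem_repr_rcoset H x.
by rewrite groupM // (subsetP sHG).
Qed.

Lemma coset_repK : cancel coset_rep coset_pt.
Proof.
move=> A; apply: val_inj; rewrite val_coset_pt ?coset_rep_in //.
have /rcosetsP[x Gx defA] := valP A; rewrite /coset_rep defA.
by apply/rcoset_eqP; rewrite mem_repr_rcoset.
Qed.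

Lemma coset_rep_pt x : x \in G ->
  exists2 h, h \in H & coset_rep (coset_pt x) = (h * x)%g.
Proof.
move=> Gx; rewrite /coset_rep val_coset_pt //.
by have /rcosetP[h Hh ->] := mem_repr_rcoset H x; exists h.
Qed.

Lemma coset_rep_act A g : g \in G ->
  exists2 h, h \in H &
    coset_rep (gact (cosets G H) A g) = (h * coset_rep A * g)%g.
Proof.
move=> Gg; rewrite -{1}[A]coset_repK coset_ptM ?coset_rep_in //.
have [|h Hh ->] := @coset_rep_pt (coset_rep A * g)%g.
  by rewrite groupM ?coset_rep_in.
by exists h; rewrite ?mulgA.
Qed.

Lemma stab_base_coset : 'C_G[base_coset | gact (cosets G H)] = H.
Proof.
have -> : base_coset = coset_pt 1.
  by apply: val_inj; rewrite val_coset_pt // mulg1.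
apply/setP=> g; rewrite !inE; have [Gg | nGg] := boolP (g \in G); last first.
  by apply/esym/negbTE; apply: contra nGg; apply: subsetP.
by rewrite sub1set inE coset_ptM // mul1g coset_pt_eq // invg1 mulg1.
Qed.

End CosetPoints.

Section PermClass.

Variables (F : fieldType) (gT : finGroupType) (G : {group gT}).

Definition perm_class (H : {group gT}) : repr_group F G :=
  repr_class (perm_mod F (cosets G H)).

Section Family.

Variables (I : finType) (H : I -> {group gT}).
Hypothesis sHG : forall i, H i \subset G.

Definition family_act (z : {i : I & cosets G (H i)}) (g : gT) :
    {i : I & cosets G (H i)} :=
  Tagged (fun i => cosets G (H i) : Type)
    (gact (cosets G (H (tag z))) (tagged z) g).

Lemma family_is_action : is_action G family_act.
Proof.
split=> [g [i A] [j B] eqAB | [i A] g h Gg Gh]; last first.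
  by congr Tagged; apply: (actMin (gact (cosets G (H i)))).
have /= eqij := congr1 (@tag _ _) eqAB; case: _ / eqij in B eqAB *.
by have /act_inj/= -> := eq_from_Tagged eqAB.
Qed.

Definition family_gset : gset G := GSet (Action family_is_action).

Lemma family_orbit x y :
  (y \in orbit (gact family_gset) G x) = (tag x == tag y).
Proof.
apply/idP/eqP=> [/orbitP[g Gg <-] // | ]; case: x y => i A [j B] /= eqij.
case: _ / eqij in B *; apply/orbitP.
exists ((coset_rep A)^-1 * coset_rep B)%g.
  by rewrite groupM ?groupV ?coset_rep_in.
rewrite /= /family_act /= -{1}[A](coset_repK (sHG i)).
by rewrite coset_ptM ?groupM ?groupV ?coset_rep_in // mulKVg coset_repK.
Qed.

Lemma repr_class_family :
  repr_class (perm_mod F family_gset) = \sum_i perm_class (H i).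
Proof.
pose b i : family_gset :=
  Tagged (fun i => cosets G (H i) : Type) (base_coset G (H i)).
have nT : [acts G, on [set: family_gset] | gact family_gset].
  by apply/subsetP=> g Gg; rewrite !inE Gg; apply/subsetP=> x; rewrite !inE.
rewrite -(repr_class_iso (perm_mod_iso F (gsubT nT))).
rewrite (@perm_mod_class_orbits _ _ _ _ [seq b i | i <- enum I]).
- rewrite big_map big_enum /=; apply: eq_bigr => i _; rewrite /perm_class.
  suff -> : 'C_G[b i | gact family_gset]%G = H i by [].
  apply: val_inj; rewrite /= -[RHS](stab_base_coset (sHG i)).
  apply/setP=> g; rewrite !inE; case: (g \in G) => //=; rewrite !sub1set !inE.
  by rewrite -[LHS]/(Tagged _ _ == Tagged _ _) eq_Tagged.
- by rewrite map_inj_uniq ?enum_uniq // => i j /(congr1 (@tag _ _)).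
- move=> _ _ /mapP[i _ ->] /mapP[j _ ->]; rewrite family_orbit /=.
  by apply/eqP/eqP=> [-> | /(congr1 (@tag _ _))].
apply/setP=> x; rewrite inE big_map big_enum /=; apply/bigcupP.
by exists (tag x) => //; rewrite family_orbit.
Qed.

End Family.

(** M is the matrix of a G-map F[X] -> F[Y], here injective between spaces
    of the same dimension. *)
Lemma perm_mod_rsim_injective (X Y : gset G) (M : X -> Y -> F) :
    #|X| = #|Y| ->
    (forall x y, {in G, forall g, M (gact X x g) (gact Y y g) = M x y}) ->
    (forall phi : X -> F,
       (forall y, \sum_x phi x * M x y = 0) -> phi =1 fun=> 0) ->
  mx_rsim (perm_mod F X) (perm_mod F Y).
Proof.
move=> eqXY eqM injM.
pose B : 'M[F]_(#|X|, #|Y|) := \matrix_(i, j) M (enum_val i) (enum_val j).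
exists B => // [|g Gg].
  rewrite -kermx_eq0; apply/rowV0P=> v /sub_kermxP vB0.
  have phi0 : (fun x => v 0 (enum_rank x)) =1 fun=> 0.
    apply: injM => y.
    have bij_enum := onW_bij (mem xpredT) (enum_val_bij (gcarrier X)).
    transitivity ((v *m B) 0 (enum_rank y)); last by rewrite vB0 mxE.
    rewrite mxE (reindex _ bij_enum) /=; apply: eq_bigr => i _.
    by rewrite enum_valK mxE enum_rankK.
  by apply/rowP=> i; have := phi0 (enum_val i); rewrite enum_valK mxE.
apply/matrixP=> i j; rewrite !mxE /=.
under eq_bigr do rewrite !mxE.
rewrite (sum_indicator enum_valK enum_rankK _
           (fun k => M (enum_val k) (enum_val j))).
under eq_bigr => k _.
  rewrite !mxE mulrC -(inj_eq (act_inj (gact Y) g^-1%g)) actKin // eq_sym; over.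
rewrite (sum_indicator enum_valK enum_rankK _
           (fun k => M (enum_val i) (enum_val k))).
by rewrite !enum_rankK -(eqM _ _ _ (groupVr Gg)) actKin.
Qed.

End PermClass.

(** * Relations from injective maps of permutation modules *)

Section CosetFamilyRelation.

Variables (F : fieldType) (gT : finGroupType) (G : {group gT}).
Variables (I J : finType) (H : I -> {group gT}) (K : J -> {group gT}).
Hypotheses (sHG : forall i, H i \subset G) (sKG : forall j, K j \subset G).

(** Equivariant matrices between H\G and K\G have entries m (x y^-1) for a
    function m on G that is left invariant under H and right invariant under
    K. *)
Lemma coset_family_relation (m : I -> J -> gT -> F) :
    (forall i j h k z, h \in H i -> k \in K j -> z \in G ->
       m i j (h * z * k)%g = m i j z) ->
    (\sum_i #|G : H i|%g = \sum_j #|G : K j|%g)%N ->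
    (forall phi : forall i, cosets G (H i) -> F,
       (forall j y, y \in G ->
          \sum_i \sum_A phi i A * m i j (coset_rep A * y^-1)%g = 0) ->
       forall i A, phi i A = 0) ->
  \sum_i perm_class F G (H i) = \sum_j perm_class F G (K j).
Proof.
move=> m_inv eq_card inj_m; rewrite -!repr_class_family //.
apply: repr_class_iso.
pose M (x : family_gset G H) (y : family_gset G K) : F :=
  m (tag x) (tag y) (coset_rep (tagged x) * (coset_rep (tagged y))^-1)%g.
apply: (@perm_mod_rsim_injective _ _ _ _ _ M).
- rewrite !card_tagged !sumnE !big_map -!enumT !big_enum /=.
  transitivity (\sum_i #|G : H i|%g)%N.
    by apply: eq_bigr => i _; rewrite card_cosets.
  by rewrite eq_card; apply: eq_bigr => j _; rewrite card_cosets.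
- move=> [i A] [j B] g Gg; rewrite /M /=.
  have [h Hh ->] := coset_rep_act (sHG i) A Gg.
  have [k Kk ->] := coset_rep_act (sKG j) B Gg.
  rewrite -[RHS](m_inv i j h k^-1%g) ?groupV ?groupM ?groupV ?coset_rep_in //.
  by congr (m i j _); rewrite !invMg !mulgA mulgK.
move=> phi phi0 [i A].
apply: (inj_m (fun i A =>
  phi (Tagged (fun i => cosets G (H i) : Type) A))) => j y Gy.
apply: etrans (phi0
  (Tagged (fun j => cosets G (K j) : Type) (coset_pt G (K j) y))).
rewrite sig_big_dep /=; apply: eq_bigr => -[i' A'] _ /=; rewrite /M /=.
have [k Kk ->] := coset_rep_pt (sKG j) Gy.
rewrite -(m_inv i' j 1%g k^-1%g) ?groupV ?groupM ?groupV ?coset_rep_in //.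
by rewrite mul1g invMg !mulgA.
Qed.

End CosetFamilyRelation.

Section NormalRelation.

Variables (F : fieldType) (gT : finGroupType) (G C : {group gT}).
Variables (J : finType) (D : J -> {group gT}) (a : J -> gT).
Hypotheses (nCG : C <| G) (nzC : #|C|%:R != 0 :> F).
Hypotheses (sDG : forall j, D j \subset G) (Ga : forall j, a j \in G).

(** The map sends the basis element x of F[G/1] to the coset Cx and to the
    cosets of (a j)^-1 x under the D j, and a coset of C(D j) to the sum of
    the cosets of D j in it.  Let (phi, psi) be in the kernel.  Summing the
    j-th equation over a coset of C removes phi, because the sums of phi
    over cosets of C vanish, and leaves |C| psi j = 0.  So only phi is left,
    and the last hypothesis says that it is zero. *)
Lemma normal_relation :
    (#|G| + \sum_j #|G : C <*> D j|%g = #|G : C|%g + \sum_j #|G : D j|%g)%N ->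
    (forall phi : gT -> F,
       {in G, forall y, \sum_(x in C) phi (x * y)%g = 0} ->
       (forall j, {in G, forall y, \sum_(d in D j) phi (a j * d * y)%g = 0}) ->
       {in G, forall y, phi y = 0}) ->
  perm_class F G 1%G + \sum_j perm_class F G (C <*> D j)%G =
    perm_class F G C + \sum_j perm_class F G (D j).
Proof.
move=> eq_dim inj_phi; have [sCG nC] := andP nCG.
have sLG j : C <*> D j \subset G by rewrite join_subG sCG sDG.
pose H i := if i is Some j then (C <*> D j)%G else 1%G.
pose K i := if i is Some j then D j else C.
pose m (i j : option J) (z : gT) : F :=
  match i, j with
  | None, None => (z \in C)%:R
  | None, Some j => ((a j)^-1 * z \in D j)%g%:R
  | Some i, Some j => ((i == j) && (z \in C <*> D j))%:R
  | Some _, None => 0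
  end.
have big_opt (R : nmodType) (E : option J -> R) :
    \sum_i E i = E None + \sum_j E (Some j).
  rewrite (bigD1 None) //=; congr (_ + _).
  rewrite (reindex_omap Some id) /=; last by case.
  by apply: eq_bigl => j; rewrite eqxx.
have sHG i : H i \subset G by case: i => [j|]; rewrite /= ?sub1G.
have sKG j : K j \subset G by case: j.
have -> : perm_class F G 1 + \sum_j perm_class F G (C <*> D j) =
    \sum_i perm_class F G (H i).
  by rewrite big_opt.
have -> : perm_class F G C + \sum_j perm_class F G (D j) =
    \sum_i perm_class F G (K i).
  by rewrite big_opt.
apply: (coset_family_relation sHG sKG (m := m)).
- move=> [i|] [j|] h k z /=; rewrite ?inE => Hh Kk Gz.
  + case: eqVneq => //= eqij; rewrite eqij in Hh.
    by rewrite groupMr ?groupMl // (subsetP (joing_subr _ _)).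
  + by [].
  + by rewrite (eqP Hh) mul1g mulgA groupMr.
  + by rewrite (eqP Hh) mul1g groupMr.
- have big_optN (E : option J -> nat) :
      (\sum_i E i = E None + \sum_j E (Some j))%N := big_opt nat E.
  by rewrite !big_optN /= indexg1.
move=> psi eq_psi.
pose phi x := psi None (coset_pt G 1 x).
have sum_None (E : gT -> F) :
    \sum_(A : cosets G 1) psi None A * E (coset_rep A) =
      \sum_(x in G) phi x * E x.
  rewrite [RHS](reindex_onto (@coset_rep _ G 1) (coset_pt G 1)) => [|x Gx].
    apply: eq_big => [A | A _].
      by rewrite (coset_rep_in (sub1G G)) (coset_repK (sub1G G)) eqxx.
    by rewrite /phi (coset_repK (sub1G G)).
  by have [h /set1P-> ->] := coset_rep_pt (sub1G G) Gx; rewrite mul1g.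
have sum_Some j y : y \in G ->
    \sum_(A : cosets G (C <*> D j))
        psi (Some j) A * (coset_rep A * y^-1 \in C <*> D j)%g%:R
      = psi (Some j) (coset_pt G (C <*> D j) y).
  move=> Gy; rewrite -[RHS](sum_indicator (b := id) (b' := id)) //.
  apply: eq_bigr => A _; rewrite mulrC eq_sym; congr (_%:R * _).
  rewrite -[A in RHS](coset_repK (sLG j)).
  by rewrite (coset_pt_eq (sLG j)) ?(coset_rep_in (sLG j)).
have shift (S : {group gT}) b y : S \subset G -> b \in G -> y \in G ->
    \sum_(x in G) phi x * (b^-1 * (x * y^-1) \in S)%g%:R =
      \sum_(s in S) phi (b * s * y)%g.
  move=> sSG Gb Gy; rewrite big_mkcond [RHS]big_mkcond.
  rewrite [LHS](reindex_inj (can_inj (mulgK y))).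
  rewrite [LHS](reindex_inj (can_inj (mulKg b))).
  apply: eq_bigr => s _ /=; rewrite mulgK mulKg groupMr // groupMl //.
  case: (boolP (s \in S)) => [Ss | _]; last by rewrite mulr0 if_same.
  by rewrite mulr1 (subsetP sSG).
have eqC : {in G, forall y, \sum_(x in C) phi (x * y)%g = 0}.
  move=> y Gy; rewrite -[RHS](eq_psi None y Gy) big_opt /=.
  rewrite [X in _ + X]big1 => [|j _].
    rewrite addr0 (sum_None (fun x => (x * y^-1 \in C)%g%:R)).
    transitivity (\sum_(x in C) phi (1 * x * y)%g).
      by apply: eq_bigr => x _; rewrite mul1g.
    by rewrite -shift //; apply: eq_bigr => x _; rewrite invg1 mul1g.
  by apply: big1 => A _; rewrite mulr0.
have eqD j y : y \in G ->
    \sum_(d in D j) phi (a j * d * y)%g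
      + psi (Some j) (coset_pt G (C <*> D j) y) = 0.
  move=> Gy; rewrite -[RHS](eq_psi (Some j) y Gy) big_opt /=; congr (_ + _).
    by rewrite (sum_None (fun x => ((a j)^-1 * (x * y^-1) \in D j)%g%:R)) shift.
  rewrite (bigD1 j) //= [X in _ + X]big1 ?addr0 => [|i ne_ij]; last first.
    by apply: big1 => A _; rewrite (negPf ne_ij) mulr0.
  by under eq_bigr do rewrite eqxx; rewrite sum_Some.
have psi_Some j y : y \in G -> psi (Some j) (coset_pt G (C <*> D j) y) = 0.
  move=> Gy; apply: (mulfI nzC); rewrite mulr0.
  have <- : \sum_(x in C) (\sum_(d in D j) phi (a j * d * (x * y))%g
      + psi (Some j) (coset_pt G (C <*> D j) (x * y)%g)) = 0.
    by apply: big1 => x Cx; rewrite eqD // groupM // (subsetP sCG).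
  rewrite big_split exchange_big /= [X in X + _]big1 => [|d Dd].
    rewrite add0r mulr_natl -sumr_const; apply: eq_bigr => x Cx.
    congr (psi _ _).
    have Gxy : (x * y)%g \in G by rewrite groupM // (subsetP sCG).
    apply/eqP; rewrite eq_sym (coset_pt_eq (sLG j)) // mulgK.
    by rewrite (subsetP (joing_subl _ _)).
  have Gad : (a j * d)%g \in G by rewrite groupM // (subsetP (sDG j)).
  rewrite -[RHS](eqC _ (groupM Gad Gy)).
  rewrite (reindex_inj (conjg_inj (a j * d)%g)) /=; apply: eq_big => x.
    by rewrite memJ_norm // (subsetP nC).
  by move=> _; rewrite conjgE !mulgA mulgV mul1g.
have phi0 : {in G, forall y, phi y = 0}.
  apply: inj_phi => [//|j y Gy]; have := eqD j y Gy.
  by rewrite psi_Some // addr0.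
case=> [j|] A; rewrite -[A](coset_repK (sHG _)).
  by rewrite psi_Some ?(coset_rep_in (sLG j)).
by apply: phi0; rewrite (coset_rep_in (sub1G G)).
Qed.

End NormalRelation.

(** * Two families of relations *)

Section ShiftVanish.

Variables (F : fieldType) (gT : finGroupType) (C : {group gT}).
Hypotheses (prC : prime #|C|) (nzC : #|C|%:R != 0 :> F).

Lemma prime_shift_invariant (e : gT) (f : gT -> F) :
    e \in C -> e != 1%g -> {in C, forall x, f (e * x)%g = f x} ->
    \sum_(x in C) f x = 0 ->
  {in C, forall x, f x = 0}.
Proof.
move=> Ce ne1 fe sum0.
have sCe : C \subset <[e]>%g.
  apply: prime_meetG => //; apply/trivgPn; exists e => //.
  by rewrite inE Ce cycle_id.
have f1 : {in C, forall x, f x = f 1%g}.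
  move=> x /(subsetP sCe) /cycleP[k ->]; elim: k => // k IHk.
  by rewrite expgS fe ?groupX.
have := sum0; rewrite (eq_bigr _ f1) sumr_const -mulr_natl => /eqP.
by rewrite mulf_eq0 (negPf nzC) => /eqP f10 x /f1 ->.
Qed.

(** The invertibility of a Vandermonde matrix over the group algebra of C,
    with nodes b i, on functions of sum zero.  One node t is eliminated by
    subtracting from the equation j + 1 the equation j translated by b t.
    By induction this gives f i (b i x) = f i (b t x), so f i is invariant
    under a generator of C; it is constant of sum zero. *)
Lemma shifts_vanish (T : eqType) (s : seq T) (b : T -> gT) (f : T -> gT -> F) :
    uniq [seq b i | i <- s] -> {in s, forall i, b i \in C} ->
    {in s, forall i, \sum_(x in C) f i x = 0} ->
    (forall j, (j < size s)%N ->
       {in C, forall x, \sum_(i <- s) f i (b i ^+ j * x)%g = 0}) ->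
  {in s, forall i, {in C, forall x, f i x = 0}}.
Proof.
have abC := cyclic_abelian (prime_cyclic prC).
elim: s f => [|t s IHs] f //= /andP[b't uniq_b] Cb aug0 shift0.
have Cbt : b t \in C by rewrite Cb ?mem_head.
have inS i : i \in s -> i \in t :: s by rewrite inE orbC => ->.
have Cbs i : i \in s -> b i \in C by move/inS/Cb.
have f0 i : i \in s -> {in C, forall x, f i x = 0}.
  move=> si; pose g i x := f i (b i * x)%g - f i (b t * x)%g.
  have shift_aug k y : k \in s -> y \in C -> \sum_(x in C) f k (y * x)%g = 0.
    move=> sk Cy; rewrite -[RHS](aug0 k (inS k sk)).
    rewrite [RHS](reindex_inj (can_inj (mulKg y))) /=.
    by apply: eq_bigl => x; rewrite groupMl.
  have g0 : {in s, forall i, {in C, forall x, g i x = 0}}.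
    apply: IHs => // [k sk | j ltj x Cx].
      by rewrite sumrB !shift_aug ?subrr // Cbs.
    have S1 := shift0 j.+1 ltj x Cx.
    have S2 := shift0 j (ltnW ltj) _ (groupM Cbt Cx).
    have := congr2 (fun u v => u - v) S1 S2; rewrite subr0 => S12.
    rewrite -[RHS]S12.
    rewrite !big_cons opprD addrACA expgSr !mulgA subrr add0r.
    rewrite -sumrB; apply: eq_big_seq => k sk; rewrite /g.
    congr (f k _ - f k _); first by rewrite mulgA -expgS.
    rewrite !mulgA; congr (_ * _)%g; apply: (centsP abC) => //.
    by rewrite groupX // Cbs.
  have ne1 : (b t * (b i)^-1)%g != 1%g.
    by rewrite -eq_mulgV1; apply: contraNneq b't => eqb; apply/mapP; exists i.
  have Cbi := Cbs i si.
  have Ce : (b t * (b i)^-1)%g \in C by rewrite groupM ?groupV.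
  apply: (prime_shift_invariant Ce ne1); last exact/aug0/inS.
  move=> x Cx; apply/eqP; rewrite eq_sym -subr_eq0; apply/eqP.
  have := g0 i si ((b i)^-1 * x)%g; rewrite /g mulKVg mulgA; apply.
  by rewrite groupM ?groupV.
move=> i; rewrite inE => /orP[/eqP-> | /f0//] x Cx.
have := shift0 0%N isT x Cx.
rewrite big_cons expg0 mul1g big_seq big1 => [|k sk].
  by rewrite addr0.
exact: f0.
Qed.

End ShiftVanish.

Section Relations.

Variables (F : fieldType) (gT : finGroupType) (G : {group gT}).

(** On the coset D C y, a function phi is a family, indexed by d in D, of
    functions f d of x in C.  The translation by c ^+ j acts on f d as
    translation by (c ^ d) ^+ j, and the nodes c ^ d are distinct because D
    acts faithfully. *)
Lemma normal_prime_relation (C D : {group gT}) :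
    C <| G -> prime #|C| -> #|C|%:R != 0 :> F ->
    D \subset G -> 'C_D(C)%g = 1%g ->
  perm_class F G 1%G + perm_class F G (C <*> D)%G *+ #|D| =
    perm_class F G C + perm_class F G D *+ #|D|.
Proof.
move=> nCG prC nzC sDG regD; have [sCG nC] := andP nCG.
have nCD := subset_trans sDG nC.
have cycC := prime_cyclic prC; have /cyclicP[c defC] := cycC.
have Cc : c \in C by rewrite defC cycle_id.
have tiCD : C :&: D = 1%g.
  apply/trivgP; rewrite -regD subsetI subsetIr.
  exact: subset_trans (subsetIl _ _) (cyclic_abelian cycC).
have sum_const (E : repr_group F G) : \sum_(j < #|D|) E = E *+ #|D|.
  by rewrite sumr_const card_ord.
rewrite -!sum_const.
apply: (normal_relation (D := fun _ => D)
          (a := fun j : 'I_#|D| => (c ^+ j)%g)) => //.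
- by move=> j; rewrite groupX // (subsetP sCG).
- rewrite !sum_nat_const !card_ord Lagrange // addnC; congr (_ + _)%N.
  have sCDG : C <*> D \subset G by rewrite join_subG sCG.
  have cardCD : #|C <*> D| = (#|C| * #|D|)%N.
    by rewrite norm_joinEr // TI_cardMg.
  have := Lagrange sCG; rewrite -(Lagrange sCDG) /= cardCD -mulnA.
  by move/eqP; rewrite eqn_pmul2l ?cardG_gt0 // => /eqP.
move=> phi phiC phiD y Gy.
pose f d x := phi (d * x * y)%g.
suff f0 : {in enum D, forall d, {in C, forall x, f d x = 0}}.
  have := f0 1%g; rewrite mem_enum /f => /(_ (group1 D) _ (group1 C)).
  by rewrite !mul1g.
apply: (shifts_vanish prC nzC (b := fun d => (c ^ d)%g)).
- rewrite map_inj_in_uniq ?enum_uniq // => d e.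
  rewrite !mem_enum => Dd De eq_cde.
  apply/eqP; rewrite eq_mulgV1 -in_set1 -[[set 1%g]]regD inE groupM ?groupV //=.
  rewrite defC cent_cycle; apply/cent1P/commute_sym/commgP/conjg_fixP.
  by rewrite conjgM eq_cde conjgK.
- by move=> d; rewrite mem_enum => Dd; rewrite memJ_norm // (subsetP nCD).
- move=> d; rewrite mem_enum => Dd; have Gd := subsetP sDG d Dd.
  rewrite -[RHS](phiC _ (groupM Gd Gy)).
  rewrite [RHS](reindex_inj (conjg_inj d^-1%g)) /=.
  apply: eq_big => x; first by rewrite memJ_norm // groupV (subsetP nCD).
  by rewrite /f (conjgCV d) mulgA.
move=> j; rewrite -cardE => ltj x Cx; have Gx := subsetP sCG x Cx.
rewrite -[RHS](phiD (Ordinal ltj) _ (groupM Gx Gy)) big_enum /=.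
by apply: eq_bigr => d _; rewrite /f -conjXg [(c ^+ j * d)%g]conjgC !mulgA.
Qed.

(** The q + 1 lines of G cover every nontrivial element once and 1 exactly q
    + 1 times.  If the sums of phi over G and over all translates of all
    lines vanish, adding those through y gives q phi(y) = 0. *)
Lemma p2Elem_relation (q : nat) :
    prime q -> q%:R != 0 :> F -> G \in 'E_q^2(G) ->
  perm_class F G 1%G + perm_class F G G *+ q =
    \sum_(H in 'E_q^1(G)) perm_class F G H.
Proof.
move=> q_pr nzq EG; have /pnElemP[_ abelG logG] := EG.
have cardE1 := card_p1Elem_p2Elem EG.
have cardG : #|G| = (q * q)%N.
  by rewrite (card_pgroup (abelem_pgroup abelG)) logG expnS expn1.
have nzG : #|G|%:R != 0 :> F by rewrite cardG natrM mulf_neq0.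
pose D (j : 'I_#|'E_q^1(G)|) := enum_val j.
have DP j : D j \in 'E_q^1(G) := enum_valP j.
have sDG j : D j \subset G by have /pnElemP[] := DP j.
have cardD j : #|D j| = q by apply: card_p1Elem (DP j).
have joinG j : (G <*> D j)%G = G.
  by apply: val_inj; rewrite /= joingC; apply/joing_idPr.
have sumD :
    \sum_(H in 'E_q^1(G)) perm_class F G H = \sum_j perm_class F G (D j).
  exact: big_enum_val.
have sumL : \sum_j perm_class F G (G <*> D j)%G = perm_class F G G *+ q.+1.
  by under eq_bigr do rewrite joinG; rewrite sumr_const card_ord cardE1.
apply: (addrI (perm_class F G G)); rewrite addrCA -mulrS -sumL sumD.
apply: (normal_relation (a := fun j => 1%g)) => //.
- have indD j : #|G : D j|%g = q.
    apply/eqP; rewrite -(eqn_pmul2l (cardG_gt0 (D j))) Lagrange //.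
    by rewrite cardG cardD.
  rewrite indexgg (eq_bigr (fun=> 1%N)) => [|j _]; last first.
    by have /(congr1 val)/= -> := joinG j; rewrite indexgg.
  rewrite [in RHS](eq_bigr (fun=> q)) // !sum_nat_const card_ord cardE1 cardG.
  by rewrite muln1 mulSn; lia.
move=> phi phiG phiD y Gy.
have sum0 : \sum_(H in 'E_q^1(G)) \sum_(d in H) phi (d * y)%g = 0.
  rewrite big_enum_val big1 // => j _.
  by rewrite -[RHS](phiD j _ Gy); apply: eq_bigr => d _; rewrite mul1g.
have split1 (H : {group gT}) :
    \sum_(d in H) phi (d * y)%g = phi y + \sum_(d in H^#) phi (d * y)%g.
  rewrite (bigD1 1%g) //= mul1g; congr (_ + _).
  by apply: eq_bigl => d; rewrite !inE andbC.
have line_eq d (H : {group gT}) : d \in G^# ->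
    (H \in 'E_q^1(G)) && (d \in H^#) = (H == <[d]>%G).
  case/setD1P=> ne1 Gd; have od := abelem_order_p abelG Gd ne1.
  rewrite p1ElemE // !inE ne1 /=.
  apply/idP/eqP=> [/andP[/andP[_ /eqP cardH] Hd] | ->].
    apply/esym/val_inj/eqP.
    by rewrite eqEcard cycle_subG Hd cardH -[#|_|]/#[d] od /=.
  by rewrite cycle_subG Gd cycle_id -[#|_|]/#[d] od eqxx.
have : \sum_(H in 'E_q^1(G)) \sum_(d in H^#) phi (d * y)%g = \sum_(d in G^#) phi (d * y)%g.
  rewrite (exchange_big_dep (mem G^#)) /= => [|H d /pnElemP[sHG _ _]]; last first.
    by apply: subsetP; apply: setSD.
  apply: eq_bigr => d Gd; rewrite (eq_bigl (pred1 <[d]>%G)) ?big_pred1_eq // => H.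
  by rewrite line_eq.
have := sum0; under eq_bigr do rewrite split1.
rewrite big_split sumr_const cardE1 /= => + sumE; rewrite sumE mulrS addrAC.
rewrite -split1 phiG // add0r -mulr_natl => /eqP.
by rewrite mulf_eq0 (negPf nzq) => /eqP.
Qed.

End Relations.

(** * Relations modulo proper subgroups, and inflation *)

Section ProperSpan.

Variables (F : fieldType) (gT : finGroupType) (G : {group gT}).

Definition proper_span (x : repr_group F G) : Prop :=
  exists c : {group gT} -> int,
    x = \sum_(H : {group gT} | H \proper G) perm_class F G H *~ c H.

Lemma proper_span0 : proper_span 0.
Proof. by exists (fun=> 0); rewrite big1. Qed.

Lemma proper_spanB x y : proper_span x -> proper_span y -> proper_span (x - y).
Proof.
move=> [c ->] [d ->]; exists (fun H => c H - d H).
by rewrite -sumrB; apply: eq_bigr => H _; rewrite mulrzBr.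
Qed.

Lemma proper_spanD x y : proper_span x -> proper_span y -> proper_span (x + y).
Proof.
move=> sx sy; rewrite -[y]opprK; apply: proper_spanB => //.
by rewrite -sub0r; apply: proper_spanB => //; apply: proper_span0.
Qed.

Lemma proper_spanMz x n : proper_span x -> proper_span (x *~ n).
Proof.
move=> [c ->]; exists (fun H => c H * n).
by rewrite mulrz_suml; apply: eq_bigr => H _; rewrite mulrzA.
Qed.

Lemma proper_span_class (H : {group gT}) :
  H \proper G -> proper_span (perm_class F G H).
Proof.
move=> pHG; exists (fun K => (K == H)%:R); rewrite (bigD1 H) //= eqxx mulr1z.
by rewrite big1 ?addr0 // => K /andP[_ /negPf->].
Qed.

(** The kernel of B(G) -> R_F(G) contains an element with coefficient a at
    G/G. *)
Definition has_relation (a : int) : Prop := proper_span (perm_class F G G *~ a).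

End ProperSpan.

Lemma eq_mx_rsim (F : fieldType) (gT : finGroupType) (G : {group gT}) n
    (rG rG' : mx_representation F G n) :
  {in G, forall g, rG g = rG' g} -> mx_rsim rG rG'.
Proof.
move=> eqG; exists 1%:M => // [|g Gg]; first by rewrite row_free_unit unitmx1.
by rewrite mulmx1 mul1mx eqG.
Qed.

Section Inflation.

Variables (F : fieldType) (gT : finGroupType) (G N : {group gT}).
Hypothesis nNG : N <| G.
Local Notation Gb := (G / N)%G.

Lemma infl_mx_repr n (rG : mx_representation F Gb n) :
  mx_repr G (fun g => rG (coset N g)).
Proof.
split=> [|g h Gg Gh]; first by rewrite morph1 repr_mx1.
have nNg := subsetP (normal_norm nNG).
by rewrite morphM ?nNg // repr_mxM ?mem_quotient.
Qed.

Definition infl_repr (U : representation F Gb) : representation F G :=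
  Representation (MxRepresentation (infl_mx_repr U)).

Lemma infl_repr_rsim (U V : representation F Gb) :
  mx_rsim U V -> mx_rsim (infl_repr U) (infl_repr V).
Proof.
by case=> B eqn freeB simB; exists B => // g Gg; rewrite /= simB ?mem_quotient.
Qed.

Lemma infl_repr_dadd (U V : representation F Gb) :
  repr_class (infl_repr (dadd_grepr U V)) =
    repr_class (infl_repr U) + repr_class (infl_repr V).
Proof. by rewrite -repr_class_add; apply/repr_class_iso/eq_mx_rsim. Qed.

Section InflGset.

Variable X : gset Gb.

Definition infl_act (x : X) (g : gT) : X := gact X x (coset N g).

Lemma infl_is_action : is_action G infl_act.
Proof.
split=> [g | x g h Gg Gh]; first exact: act_inj.
have nNg := subsetP (normal_norm nNG).
by rewrite /infl_act morphM ?nNg // actMin ?mem_quotient.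
Qed.

Definition infl_gset : gset G := GSet (Action infl_is_action).

Lemma infl_perm_mod :
  repr_class (infl_repr (perm_mod F X)) = repr_class (perm_mod F infl_gset).
Proof. by apply/repr_class_iso/eq_mx_rsim. Qed.

End InflGset.

Lemma cosetpre_sub (K : {group coset_of N}) :
  K \subset Gb -> coset N @*^-1 K \subset G.
Proof. by move=> sKG; rewrite -(quotientGK nNG) cosetpreSK. Qed.

(** G acts transitively on the inflated coset space, and the stabilizer of
    the base point is the preimage of K. *)
Lemma infl_perm_class (K : {group coset_of N}) : K \subset Gb ->
  repr_class (perm_mod F (infl_gset (cosets Gb K))) =
    perm_class F G (coset N @*^-1 K)%G.
Proof.
move=> sKG; set X := infl_gset _.
have orbX (A B : X) : A \in orbit (gact X) G B.
  pose gb := ((coset_rep (B : cosets Gb K))^-1 * coset_rep (A : cosets Gb K))%g.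
  have /morphimP[g _ Gg def_g] : gb \in Gb.
    by rewrite groupM ?groupV ?coset_rep_in.
  apply/orbitP; exists g => //; rewrite /= /infl_act -def_g.
  rewrite -{1}[B](coset_repK sKG) coset_ptM ?(coset_rep_in sKG) //.
    by rewrite mulKVg (coset_repK sKG).
  by rewrite groupM ?groupV ?(coset_rep_in sKG).
have nT : [acts G, on [set: X] | gact X].
  by apply/subsetP=> g Gg; rewrite !inE Gg; apply/subsetP=> x; rewrite !inE.
rewrite -(repr_class_iso (perm_mod_iso F (gsubT nT))).
rewrite (@perm_mod_class_orbits _ _ _ _ [:: base_coset Gb K : X]) //.
- rewrite big_seq1 /perm_class.
  suff -> : 'C_G[base_coset Gb K : X | gact X]%G = (coset N @*^-1 K)%G by [].
  apply: val_inj => /=; apply/setP=> g.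
  have [Gg | nGg] := boolP (g \in G); last first.
    rewrite inE (negPf nGg); apply/esym/negbTE; apply: contra nGg.
    exact: (subsetP (cosetpre_sub sKG)).
  have Ng : g \in 'N(N) by rewrite (subsetP (normal_norm nNG)).
  have Gbg : coset N g \in Gb by rewrite mem_quotient.
  transitivity (coset N g \in K); last first.
    by apply/idP/morphpreP=> [Kg | []].
  by rewrite -[in RHS](stab_base_coset sKG) !inE Gg Gbg /= !sub1set !inE.
- by move=> A B /[!inE] /eqP-> /eqP->; rewrite orbX eqxx.
by rewrite big_seq1; apply/setP=> A; rewrite orbX inE.
Qed.

Lemma has_relation_quotient a : has_relation F Gb a -> has_relation F G a.
Proof.
case=> c rel.
have [phi phiE] := repr_group_lift
  (f := fun U => repr_class (infl_repr U))
  (fun U V simUV => repr_class_iso (infl_repr_rsim simUV)) infl_repr_dadd.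
have phi_class (K : {group coset_of N}) : K \subset Gb ->
    phi (perm_class F Gb K) = perm_class F G (coset N @*^-1 K)%G.
  by move=> sKG; rewrite phiE infl_perm_mod infl_perm_class.
have defG : (coset N @*^-1 Gb)%G = G by apply: val_inj; rewrite /= quotientGK.
have := congr1 phi rel; rewrite raddfMz /= phi_class // defG raddf_sum.
rewrite /has_relation => ->.
elim/big_ind: _ => [|x y|K pKG]; [exact: proper_span0 | exact: proper_spanD |].
rewrite raddfMz /= phi_class ?proper_sub //; apply/proper_spanMz/proper_span_class.
by have := pKG; rewrite -cosetpre_proper /= quotientGK.
Qed.

End Inflation.

(** * Coefficient q for the two minimal types of groups *)

Section MinimalGroups.

Variables (F : finFieldType) (gT : finGroupType) (G : {group gT}) (q : nat).
Hypothesis q_pr : prime q.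

Lemma p2Elem_has_relation :
  q%:R != 0 :> F -> G \in 'E_q^2(G) -> has_relation F G q.
Proof.
move=> nzq EG; have /pnElemP[_ abelG logG] := EG.
have cardG : #|G| = (q * q)%N.
  by rewrite (card_pgroup (abelem_pgroup abelG)) logG expnS expn1.
have q_gt1 := prime_gt1 q_pr; have q_gt0 := prime_gt0 q_pr.
rewrite /has_relation -pmulrn.
have -> : perm_class F G G *+ q =
    \sum_(H in 'E_q^1(G)) perm_class F G H - perm_class F G 1%G.
  by rewrite -(p2Elem_relation q_pr nzq EG) addrC addKr.
apply: proper_spanB; last first.
  apply: proper_span_class; rewrite properEcard sub1G cards1 cardG.
  by rewrite (leq_trans q_gt1) ?leq_pmulr.
elim/big_ind: _ => [|x y|H EH]; [exact: proper_span0 | exact: proper_spanD |].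
apply: proper_span_class; have /pnElemP[sHG _ _] := EH.
by rewrite properEcard sHG (card_p1Elem EH) cardG ltn_Pmulr.
Qed.

(** Subtract the relation of normal_prime_relation for D = Q', of index q in
    Q, from the one for D = Q.  The terms at 1 and C cancel, and all other
    coefficients are divisible by |Q'|, with quotient q at G/G. *)
Lemma faithful_prime_has_relation (C Q : {group gT}) :
    C <| G -> prime #|C| -> #|C|%:R != 0 :> F -> (C * Q)%g = G ->
    q.-group Q -> Q :!=: 1%g -> 'C_Q(C)%g = 1%g ->
  has_relation F G q.
Proof.
move=> nCG prC nzC defG qQ ntQ regQ; have [sCG nC] := andP nCG.
have sQG : Q \subset G by rewrite -defG mulG_subr.
have [Q' [_ /andP[sQ'Q _] cardQ']] :=
  normal_pgroup qQ (normal_refl Q) (leq_pred _).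
have cardQ : #|Q| = (q * #|Q'|)%N.
  have [_ dvqQ _] := pgroup_pdiv qQ ntQ.
  rewrite cardQ' {1}(card_pgroup qQ) -expnS prednK // logn_gt0.
  by rewrite mem_primes q_pr cardG_gt0.
have sQ'G := subset_trans sQ'Q sQG.
have regQ' : 'C_Q'(C)%g = 1%g by apply/trivgP; rewrite -regQ setSI.
have joinQ : (C <*> Q)%G = G.
  by apply: val_inj; rewrite /= norm_joinEr // (subset_trans sQG).
have abC : C \subset 'C(C) := cyclic_abelian (prime_cyclic prC).
have tiCQ : C :&: Q = 1%g.
  by apply/trivgP; rewrite -regQ subsetI subsetIr (subset_trans (subsetIl _ _)).
have cardG : #|G| = (#|C| * #|Q|)%N by rewrite -defG TI_cardMg.
have C_gt1 := prime_gt1 prC.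
have pQG : Q \proper G by rewrite properEcard sQG cardG ltn_Pmull.
have pQ'G : Q' \proper G by rewrite (sub_proper_trans sQ'Q).
have pCQ'G : C <*> Q' \proper G.
  rewrite properEcard join_subG sCG sQ'G norm_joinEr ?(subset_trans sQ'G) //.
  rewrite cardG TI_cardMg; last by apply/trivgP; rewrite -tiCQ setIS.
  by rewrite ltn_pmul2l ?cardG_gt0 // cardQ ltn_Pmull ?prime_gt1.
have R1 := normal_prime_relation nCG prC nzC sQG regQ.
have R2 := normal_prime_relation nCG prC nzC sQ'G regQ'.
rewrite joinQ in R1.
pose y :=
  perm_class F G Q *+ q + perm_class F G (C <*> Q')%G - perm_class F G Q'.
suff defy : perm_class F G G *~ q = y.
  rewrite /has_relation defy; apply: proper_spanB; last exact: proper_span_class.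
  apply: proper_spanD; last exact: proper_span_class.
  by rewrite pmulrn; apply/proper_spanMz/proper_span_class.
apply/eqP; rewrite -subr_eq0; apply/eqP.
apply: (@repr_group_torsion_free _ _ _ _ #|Q'|); first by rewrite -lt0n.
rewrite /y -!pmulrn !mulrnBl mulrnDl -!mulrnA -cardQ.
have -> : perm_class F G G *+ #|Q| =
    perm_class F G C + perm_class F G Q *+ #|Q| - perm_class F G 1%G.
  by rewrite -R1 addrC addKr.
have -> : perm_class F G (C <*> Q')%G *+ #|Q'| =
    perm_class F G C + perm_class F G Q' *+ #|Q'| - perm_class F G 1%G.
  by rewrite -R2 addrC addKr.
move: (perm_class F G Q *+ _) (perm_class F G Q' *+ _) => u v.
by rewrite [_ + v - _]addrAC (addrA u) addrK addrA [u + _]addrC subrr.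
Qed.

End MinimalGroups.

(** * Reduction of Dress groups to the minimal types *)

Section Reduction.

Variables (p q : nat) (F : finFieldType).
Hypotheses (p_pr : prime p) (q_pr : prime q) (charF : p \in [pchar F]).

Lemma quasi_elementary_quotient (gT : finGroupType) (G N : {group gT}) :
  G \subset 'N(N) -> quasi_elementary q G -> quasi_elementary q (G / N)%g.
Proof.
move=> nNG /existsP[C /and3P[nCG cycC qGC]]; apply/existsP; exists (C / N)%G.
rewrite quotient_normal ?quotient_cyclic //=.
by apply: pnat_dvd qGC; rewrite index_quotient // subIset ?nNG.
Qed.

Lemma hypo_elementary_cyclic (gT : finGroupType) (G : {group gT}) :
  cyclic G -> hypo_elementary p G.
Proof.
move=> cycG; apply/existsP; exists 1%G.
by rewrite normal1 pgroup1 quotient_cyclic.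
Qed.

Lemma hypo_elementary_quotient (gT : finGroupType) (G N : {group gT}) :
  N <| G -> p.-group N -> hypo_elementary p (G / N)%g -> hypo_elementary p G.
Proof.
move=> nNG pN /existsP[P /and3P[nPG pP cycP]]; have [sNG nNG'] := andP nNG.
have [R defP sNR nRG] := inv_quotientN nNG nPG; apply/existsP; exists R.
rewrite nRG -(pquotient_pgroup pN) ?(subset_trans (normal_sub nRG)) // -defP pP.
by rewrite -(isog_cyclic (third_isog sNR nNG nRG)) -defP.
Qed.

(** By Burnside's basis theorem the Frattini quotient is not cyclic either,
    so it has an elementary abelian quotient of order q^2. *)
Lemma noncyclic_pgroup_has_relation (gT : finGroupType) (G : {group gT}) :
  q%:R != 0 :> F -> q.-group G -> ~~ cyclic G -> has_relation F G q.
Proof.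
move=> nzq qG ncG; apply: (has_relation_quotient (Phi_normal G)).
set E := (G / _)%G; have abelE : q.-abelem E by apply: Phi_quotient_abelem.
have ncE : ~~ cyclic E by apply: contra ncG; apply: Phi_quotient_cyclic.
rewrite (abelem_cyclic abelE) -ltnNge in ncE.
have [N [sNE nNE cardN]] :=
  normal_pgroup (abelem_pgroup abelE) (normal_refl E) (leq_subr 2 _).
apply: (has_relation_quotient nNE); apply: p2Elem_has_relation => //.
apply/pnElemP; split=> //; first exact: quotient_abelem.
rewrite card_quotient ?normal_norm // -divgS // logn_div ?cardSg // cardN.
by rewrite pfactorK // subKn.
Qed.

(** Dividing by the centralizer K of C in Q makes the action faithful: an
    element that centralizes C modulo K has commutators with C in the
    intersection of C and K, which is trivial. *)
Lemma prime_has_relation (gT : finGroupType) (G C Q : {group gT}) :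
    C <| G -> prime #|C| -> #|C|%:R != 0 :> F -> (C * Q)%g = G ->
    q.-group Q -> coprime #|C| #|Q| -> ~~ (Q \subset 'C(C)) ->
  has_relation F G q.
Proof.
move=> nCG prC nzC defG qQ coCQ ncQ; have [sCG nC] := andP nCG.
have sQG : Q \subset G by rewrite -defG mulG_subr.
have tiCQ := coprime_TIg coCQ.
pose K := 'C_Q(C)%G; have sKQ : K \subset Q := subsetIl _ _.
have tiCK : C :&: K = 1%g by apply/trivgP; rewrite -tiCQ setIS.
have nKQ : Q \subset 'N(K).
  by rewrite normsI ?normG // norms_cent // (subset_trans sQG).
have nKC : C \subset 'N(K) by rewrite cents_norm // centsC subsetIr.
have nKG : K <| G by rewrite /normal (subset_trans sKQ) // -defG mul_subG.
apply: (has_relation_quotient nKG).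
have cardC : #|(C / K)%g| = #|C|.
  by apply/esym/card_isog/quotient_isog; rewrite // setIC.
apply: (@faithful_prime_has_relation _ _ _ _ q_pr (C / K) (Q / K)).
- exact: quotient_normal.
- by rewrite cardC.
- by rewrite cardC.
- by rewrite -quotientMl // defG.
- exact: quotient_pgroup.
- rewrite -subG1 quotient_sub1 //; apply: contra ncQ => sQK.
  exact: subset_trans sQK (subsetIr _ _).
have [X defX sKX sXQ] :=
  inv_quotientS (normalS sKQ sQG nKG) (subsetIl (Q / K)%g 'C(C / K)%g).
have nKX := subset_trans sXQ nKQ.
have nCX : X \subset 'N(C) := subset_trans sXQ (subset_trans sQG nC).
rewrite /= defX; apply/eqP; rewrite -subG1 quotient_sub1 //.
apply/subsetIP; split=> //; apply/commG1P/trivgP.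
rewrite -tiCK subsetI commg_subr nCX /=.
by rewrite -quotient_cents2 // -defX subsetIr.
Qed.

(** Let M be a maximal subgroup of C that contains the fixed points of Q.
    By coprime action, the fixed points of Q on C/M are the image of those
    on C, hence trivial, so Q acts nontrivially on C/M, which has prime
    order. *)
Lemma coprime_has_relation (gT : finGroupType) (G C Q : {group gT}) :
    C <| G -> cyclic C -> p^'.-group C -> (C * Q)%g = G ->
    q.-group Q -> coprime #|C| #|Q| -> ~~ (Q \subset 'C(C)) ->
  has_relation F G q.
Proof.
move=> nCG cycC p'C defG qQ coCQ ncQ; have [sCG nC] := andP nCG.
have sQG : Q \subset G by rewrite -defG mulG_subr.
have nCQ := subset_trans sQG nC.
have abC := cyclic_abelian cycC.
have [eqC | [M maxM sFM]] := maximal_exists (subsetIl C 'C(Q)).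
  by case/negP: ncQ; rewrite centsC -eqC subsetIr.
have [/andP[sMC not_sCM] maxM'] := maxgroupP maxM.
have nMC : C \subset 'N(M).
  by rewrite (subset_trans abC) // (subset_trans (centS sMC)) ?cent_sub.
have nMG : M <| G by apply: char_normal_trans nCG; rewrite sub_cyclic_char.
have nMQ := subset_trans sQG (normal_norm nMG).
have prCM : prime #|(C / M)%g|.
  rewrite card_quotient //; apply: index_maxnormal_sol_prime (abelian_sol abC) _.
  apply/maxgroupP; split=> [|H /andP[pHC _]]; last exact: maxM'.
  by rewrite properE sMC not_sCM.
apply: (has_relation_quotient nMG).
apply: (@prime_has_relation _ _ (C / M) (Q / M)) => //.
- exact: quotient_normal.
- rewrite -(dvdn_pcharf charF) -p'natE //.
  by apply: quotient_pgroup.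
- by rewrite -quotientMl // defG.
- exact: quotient_pgroup.
- exact: coprime_morph.
apply: contra not_sCM; rewrite centsC => cCQ.
have coMQ : coprime #|M| #|Q| by apply: coprimeSg coCQ.
have := coprime_norm_quotient_cent nCQ nMQ coMQ (abelian_sol (abelianS sMC abC)).
rewrite (setIidPl cCQ) => /esym eqCM; rewrite -quotient_sub1 // eqCM.
by rewrite quotient_sub1 // subIset ?nMC.
Qed.

(** Let C be the q'-part of the cyclic normal subgroup; it is a p'-group
    since O_p(G) = 1, and G = CQ for a Sylow q-subgroup Q.  If Q centralizes
    C, then Q is not cyclic, since otherwise G = C x Q would be cyclic; and
    q <> p, since otherwise Q <= O_p(G) = 1. *)
Lemma reduced_has_relation (gT : finGroupType) (G : {group gT}) :
    quasi_elementary q G -> 'O_p(G)%g = 1%g -> ~~ hypo_elementary p G ->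
  has_relation F G q.
Proof.
case/existsP=> C0 /and3P[nC0G cycC0 qGC0] Op1 nhG.
have nilC0 := abelian_nil (cyclic_abelian cycC0).
pose C := 'O_q^'(C0)%G; have sCC0 : C \subset C0 := pcore_sub _ _.
have hallC : q^'.-Hall(C0) C := nilpotent_pcore_Hall _ nilC0.
have cycC := cyclicS sCC0 cycC0.
have nCG : C <| G := gFnormal_trans _ nC0G.
have [sCG nC] := andP nCG.
have qGC : q.-nat #|G : C|%g.
  rewrite -(Lagrange_index (normal_sub nC0G) sCC0) pnatM qGC0 /=.
  by case/and3P: hallC => _ _; rewrite pnatNK.
have p'C : p^'.-group C.
  have nilC := abelian_nil (cyclic_abelian cycC).
  have OpC : 'O_p(C)%g = 1%g.
    by apply/trivgP; rewrite -Op1 pcore_max ?pcore_pgroup // gFnormal_trans.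
  have := card_Hall (nilpotent_pcore_Hall p nilC).
  by rewrite /= OpC cards1 => /esym/eqP; rewrite partG_eq1.
have [Q sylQ] := Sylow_exists q G; have [sQG qQ _] := and3P sylQ.
have defG := mul_Sylow_index nCG qGC sylQ.
have coCQ : coprime #|C| #|Q|.
  by rewrite coprime_sym (pnat_coprime qQ (pHall_pgroup hallC)).
have [cCQ | ncQ] := boolP (Q \subset 'C(C)); last first.
  exact: coprime_has_relation ncQ.
have ncycQ : ~~ cyclic Q.
  apply: contra nhG => cycQ; apply: hypo_elementary_cyclic; rewrite -defG.
  by apply: cyclicM.
have ne_pq : p != q.
  apply: contraNneq ncycQ => eq_pq.
  have nQG : Q <| G.
    by rewrite /normal sQG -defG mul_subG ?normG // cents_norm // centsC.
  have sQO : Q \subset 'O_p(G)%g by rewrite pcore_max // eq_pq.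
  by rewrite (trivgP (subset_trans sQO _)) ?cyclic1 // Op1.
have nzq : q%:R != 0 :> F.
  by rewrite -(dvdn_pcharf charF) dvdn_prime2.
apply: (has_relation_quotient nCG); apply: noncyclic_pgroup_has_relation => //.
  by rewrite /pgroup card_quotient.
rewrite /= -defG quotientMidl; apply: contra ncycQ.
have isoQ := quotient_isog (subset_trans sQG nC) (coprime_TIg coCQ).
by rewrite -(isog_cyclic isoQ).
Qed.

Theorem dress_has_relation (gT : finGroupType) (G : {group gT}) :
  dress p q G -> ~~ hypo_elementary p G -> has_relation F G q.
Proof.
case/existsP=> P /and3P[nPG pP qeGP] nhG; apply: (has_relation_quotient nPG).
have nhGP : ~~ hypo_elementary p (G / P)%g.
  by apply: contra nhG; apply: hypo_elementary_quotient.
apply: (has_relation_quotient (pcore_normal p (G / P))).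
apply: reduced_has_relation.
- by apply: quasi_elementary_quotient qeGP; apply: gFnorm.
- exact: trivg_pcore_quotient.
apply: contra nhGP.
exact: hypo_elementary_quotient (pcore_normal _ _) (pcore_pgroup _ _).
Qed.

End Reduction.

(** * Translation to the Burnside group *)

Section Coefficients.

Variables (p q : nat) (F : finFieldType) (gT : finGroupType) (G : {group gT}).
Hypotheses (p_pr : prime p) (q_pr : prime q).
Hypotheses (cardF : #|F| = p) (charF : p \in [pchar F]).
Implicit Types (H : subgroup_of G) (a : int) (c : subgroup_of G -> int).

Lemma proper_whole_group H : (val H \proper G) = (H != whole_group G).
Proof.
by rewrite properEneq (valP H) andbT -val_eqE /= -val_eqE.
Qed.

Lemma perm_kernel_comb a c :
  (a *: coset_class (whole_group G)
     + \sum_(H : subgroup_of G | val H \proper G) c H *: coset_class H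
   \in perm_kernel G F) =
  (perm_class F G G *~ a
     + \sum_(H : subgroup_of G | val H \proper G)
         perm_class F G (val H) *~ c H == 0).
Proof.
have repr_scale n H :
    burnside_repr F (n *: coset_class H) = perm_class F G (val H) *~ n.
  by rewrite -{1}[n]intz scaler_int raddfMz /= burnside_repr_coset.
rewrite unfold_in /= raddfD /= repr_scale; congr (_ + _ == 0).
rewrite (raddf_sum (burnside_repr F)).
by apply: eq_bigr => H _; rewrite /= repr_scale.
Qed.

Lemma relation_dvd a c : dress p q G ->
  perm_class F G G *~ a
    + \sum_(H : subgroup_of G | val H \proper G)
        perm_class F G (val H) *~ c H = 0 ->
  (q %| a)%Z.
Proof.
case/existsP=> P /and3P[nPG pP /existsP[Cb /and3P[nCb cycCb qCb]]] rel.
have [C defCb sPC nCG] := inv_quotientN nPG nCb.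
pose X H := cosets G (val H).
pose c' H := if H == whole_group G then a else c H.
have relX : \sum_H repr_class (perm_mod F (X H)) *~ c' H = 0.
  rewrite (bigD1 (whole_group G)) //= /c' eqxx -[RHS]rel; congr (_ + _).
  apply: eq_big => [H | H /negPf-> //]; by rewrite proper_whole_group.
have qGC : q.-nat #|G : C|%g.
  have := qCb; rewrite defCb.
  rewrite index_quotient_eq ?(normal_norm nPG) ?(normal_sub nCG) //.
  by rewrite subIset // sPC orbT.
have nPC : P <| C := normalS sPC (normal_sub nCG) nPG.
have cycCP : cyclic (C / P)%g by rewrite -defCb.
have := dvdz_virtual_mark p_pr cardF (pcharf0 charF) relX nCG qGC nPC pP cycCP.
rewrite /virtual_mark (bigD1 (whole_group G)) //= big1 => [|H neqHG].
  by rewrite addr0 /c' eqxx (card_afix_cosets (subxx G)) eqxx mul1r.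
rewrite -proper_whole_group properEneq in neqHG.
rewrite card_afix_cosets ?(valP H) //.
by case/andP: neqHG => /negPf-> _; rewrite mul0r.
Qed.

Lemma relation_exists a : has_relation F G q -> (q %| a)%Z ->
  exists c, perm_class F G G *~ a
    + \sum_(H : subgroup_of G | val H \proper G)
        perm_class F G (val H) *~ c H = 0.
Proof.
move=> [c rel] /dvdzP[k ->]; exists (fun H => - (c (val H) * k)).
rewrite [k * _]mulrC mulrzA rel.
rewrite (reindex_onto val (insubd (whole_group G))) => [|H pHG]; last first.
  by rewrite insubdK //; apply: proper_sub pHG.
rewrite mulrz_suml (eq_bigl (fun H : subgroup_of G => val H \proper G));
  last by move=> H; rewrite valKd eqxx andbT.
by rewrite -big_split big1 // => H _ /=; rewrite mulrNz mulrzA subrr.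
Qed.

End Coefficients.

Theorem theorem1p3 (p q : nat) (gT : finGroupType) (G : {group gT}) (a : int) :
  prime p -> prime q -> dress p q G -> ~~ hypo_elementary p G ->
  (exists c : subgroup_of G -> int,
     a *: coset_class (whole_group G)
       + \sum_(H : subgroup_of G | val H \proper G) c H *: coset_class H
     \in perm_kernel G 'F_p)
  <-> (q %| a)%Z.
Proof.
move=> p_pr q_pr dressG nhG; have charF := pchar_Fp p_pr.
split=> [[c relc] | dvd_qa].
  apply: (relation_dvd p_pr (card_Fp p_pr) charF (c := c) dressG).
  by apply/eqP; rewrite -perm_kernel_comb.
have rel_q := dress_has_relation p_pr q_pr charF dressG nhG.
have [c relc] := relation_exists rel_q dvd_qa.
by exists c; have := perm_kernel_comb 'F_p a c => ->; apply/eqP.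
Qed.
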